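(* Let $\Omega\subset\mathbb{R}^n$ be an open set, let $w$ be a positive real analytic function on $\Omega$, and let $u\in\mathcal{H}(\Omega,l^2,w\,dx)$, i.e. $u$ is strongly harmonic in $\Omega$ with respect to the Euclidean distance and the measure $w\,dx$. Then for every $l\in\mathbb{N}$ such that $\Delta^l w$ is positive in $\Omega$, the function $u$ is strongly harmonic in $\Omega$ with respect to the Euclidean distance and the measure $\Delta^l w\,dx$, i.e. $u\in\mathcal{H}(\Omega,l^2,\Delta^l w\,dx)$.
   Context: $\Delta^l$ denotes the $l$-fold composition of the Laplace operator $\Delta=\sum_{i=1}^n\partial^2/\partial x_i^2$ (with $\Delta^0 w=w$). For a positive weight $v$ on $\Omega$, with $B(x,r)$ denoting Euclidean balls, a locally integrable function $u:\Omega\to\mathbb{R}$ is strongly harmonic in $\Omega$ with respect to the Euclidean ($l^2$) distance and the measure $d\mu=v\,dx$ if for every ball $B(x,r)\Subset\Omega$ (closure compact and contained in $\Omega$) $$u(x)=\frac{1}{\mu(B(x,r))}\int_{B(x,r)}u(y)\,d\mu(y),\qquad \mu(B(x,r))=\int_{B(x,r)}v\,dx.$$ The space of all such functions is denoted $\mathcal{H}(\Omega,l^2,v\,dx)$. *)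

(* Defs.v *)
From HB Require Import structures.
From mathcomp Require Import all_boot all_order all_algebra.
From mathcomp Require Import all_classical all_reals all_analysis.

Set Implicit Arguments.
Unset Strict Implicit.
Unset Printing Implicit Defensive.

Import Order.TTheory GRing.Theory Num.Theory.
Import numFieldNormedType.Exports.

Local Open Scope classical_set_scope.
Local Open Scope ring_scope.

(* R^n is 'rV[R]_n; its library topology comes from the sup norm, which induces
   the Euclidean topology. *)

Section measurable_rV.
Context {d} {T : sigmaRingType d} (n : nat).

(* The product sigma-algebra (for T := R, the Borel sets of R^n), in the same
   style as the library instance on n.-tuple T. *)
Let coors : 'I_n -> 'rV[T]_n -> T := fun i x => x ord0 i.

Let rV_set0 : g_sigma_preimage coors set0.
Proof. exact: sigma_algebra0. Qed.

Let rV_setC A : g_sigma_preimage coors A -> g_sigma_preimage coors (~` A).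
Proof. exact: sigma_algebraC. Qed.

Let rV_bigcup (F : _^nat) : (forall i, g_sigma_preimage coors (F i)) ->
  g_sigma_preimage coors (\bigcup_i (F i)).
Proof. exact: sigma_algebra_bigcup. Qed.

HB.instance Definition _ := @isMeasurable.Build (measure_tuple_display d)
  'rV[T]_n (g_sigma_preimage coors) rV_set0 rV_setC rV_bigcup.

End measurable_rV.

Section lebesgue_measure_rV.
Context {R : realType}.

Definition cons_rV n (p : measurableTypeR R * 'rV[R]_n) : 'rV[R]_n.+1 :=
  \row_(i < n.+1) (if unlift ord0 i is Some j then p.2 ord0 j else p.1).

Lemma measurable_coord_rV n (i : 'I_n) :
  measurable_fun [set: 'rV[R]_n] (fun x : 'rV[R]_n => x ord0 i).
Proof.
move=> _ Y mY; rewrite setTI; apply: sub_sigma_algebra => /=.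
rewrite -bigcup_seq/=; exists i => /=; first by rewrite mem_index_enum.
by exists Y => //; rewrite setTI.
Qed.

Lemma measurable_fun_rVP d (T : measurableType d) n (f : T -> 'rV[R]_n) :
  (forall i, measurable_fun [set: T] (fun t => f t ord0 i)) ->
  measurable_fun [set: T] f.
Proof.
move=> mf _ A mA; rewrite setTI.
pose G : set_system 'rV[R]_n := [set B | measurable (f @^-1` B)].
suff : G A by [].
move: A mA; apply: smallest_sub => /=.
  split => [|B GB|F GF].
  - by rewrite /G /= preimage_set0.
  - by rewrite /G /= setTD preimage_setC; exact: measurableC.
  - by rewrite /G /= preimage_bigcup; exact: bigcupT_measurable.
move=> B; rewrite -bigcup_seq/= => -[i _ [C mC <-]].
by rewrite setTI /G /= -[X in measurable X]setTI; exact: mf.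
Qed.

Lemma measurable_cons_rV n : measurable_fun setT (@cons_rV n).
Proof.
apply: measurable_fun_rVP => i; under eq_fun do rewrite mxE.
case: unlift => [j|]; last exact: measurable_fst.
exact: (measurableT_comp (measurable_coord_rV j) measurable_snd).
Qed.

Section prod_rV.
Variables (n : nat) (mu : {measure set 'rV[R]_n -> \bar R}).

Definition lebesgue_prod_rV : set 'rV[R]_n.+1 -> \bar R :=
  pushforward (lebesgue_measure \x^ mu)%E (@cons_rV n).

Let mcons : measurable_fun setT (@cons_rV n) := @measurable_cons_rV n.

Let prod0 : lebesgue_prod_rV set0 = 0.
Proof. exact: measure0. Qed.

Let prod_ge0 A : (0 <= lebesgue_prod_rV A)%E.
Proof. exact: measure_ge0. Qed.

Let prod_sigma_additive : semi_sigma_additive lebesgue_prod_rV.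
Proof. exact: measure_semi_sigma_additive. Qed.

HB.instance Definition _ := isMeasure.Build _ _ _ lebesgue_prod_rV
  prod0 prod_ge0 prod_sigma_additive.

End prod_rV.

(* The n-fold product of the Lebesgue measure of R, on the Borel sets of R^n. *)
Fixpoint borel_lebesgue_rV n : {measure set 'rV[R]_n -> \bar R} :=
  if n is m.+1 then lebesgue_prod_rV (borel_lebesgue_rV m)
  else \d_(0 : 'rV[R]_0).

(* R^n with the sigma-algebra of Lebesgue measurable sets, and the (complete)
   Lebesgue measure on it. *)
Definition lebesgueType n := caratheodory_type (borel_lebesgue_rV n)^*%mu.

HB.instance Definition _ n := Measurable.on (lebesgueType n).

Definition lebesgue_rV n : set (lebesgueType n) -> \bar R :=
  @completed_measure_extension _ _ _ (borel_lebesgue_rV n).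

HB.instance Definition _ n := Measure.on (@lebesgue_rV n).

End lebesgue_measure_rV.
Arguments lebesgueType : clear implicits.
Arguments lebesgue_rV {R} n.

Section strongly_harmonic.
Context {R : realType} {n : nat}.
Implicit Types (Omega K : set 'rV[R]_n) (u v w : 'rV[R]_n -> R) (x y a : 'rV[R]_n).

Definition l2dist x y : R := Num.sqrt (\sum_(i < n) (x ord0 i - y ord0 i) ^+ 2).

Definition l2ball x (r : R) : set 'rV[R]_n := [set y | l2dist x y < r].

Definition compactly_contained (B Omega : set 'rV[R]_n) :=
  compact (closure B) /\ closure B `<=` Omega.

(* Local integrability with respect to v dx. Functions on Omega are encoded as
   total functions, only their values on Omega matter. *)
Definition locally_integrable_wrt Omega v u :=
  @measurable_fun _ _ (lebesgueType R n) R Omega u /\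
  forall K, K `<=` Omega -> compact K ->
    (\int[lebesgue_rV n]_(y in K) (`|u y| * v y)%:E < +oo)%E.

(* H(Omega, l^2, v dx) *)
Definition strongly_harmonic Omega v u :=
  locally_integrable_wrt Omega v u /\
  forall x (r : R), 0 < r -> compactly_contained (l2ball x r) Omega ->
    u x = (\int[lebesgue_rV n]_(y in l2ball x r) v y)^-1 *
          \int[lebesgue_rV n]_(y in l2ball x r) (u y * v y).

Definition laplacian w : 'rV[R]_n -> R := fun x =>
  \sum_(i < n) 'D_(delta_mx ord0 i) ('D_(delta_mx ord0 i) w) x.

Definition monomial (al : 'I_n -> nat) (h : 'rV[R]_n) : R :=
  \prod_(i < n) h ord0 i ^+ al i.

(* Near each point of Omega, w is the sum of an absolutely convergent power
   series; given absolute convergence, the sum over all multi-indices is the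
   limit of the sums over the cubes {0, ..., N-1}^n. *)
Definition real_analytic Omega w := forall a, Omega a ->
  exists c : {ffun 'I_n -> nat} -> R, \forall x \near a,
    summable [set: {ffun 'I_n -> nat}]
      (fun al => (c al * monomial al (x - a))%:E) /\
    \sum_(be : {ffun 'I_n -> 'I_N})
      c [ffun i => be i : nat] * monomial (fun i => be i) (x - a)
      @[N --> \oo] --> w x.

End strongly_harmonic.

(* Main.v *)
(* Fix x and write h = (u - u(x)) w; strong harmonicity says that h integrates to
   0 over every small ball about x, hence so does p(|y - x|) h for every
   polynomial p.  Testing with the cutoffs (r^2 - |y - x|^2)_+^m, m >= 3, whose
   Laplacian is again radial, Green's formula gives
     int (r^2 - |y - x|^2)_+^m (Delta(uw) - u(x) Delta w) dy = 0.
   Letting r tend to 0, Delta(uw) = u Delta w holds pointwise, so the same moments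
   of (u - u(x)) Delta w vanish; combining the exponents m, its integral over the
   ball vanishes as well.  This passes from w to Delta w without using the sign of
   Delta w, so it iterates.  Only the continuity of the derivatives of w and two
   derivatives of u are needed; the latter come from differentiating under the
   integral sign in the mean value formula for the weight (r^2 - |x - y|^2)_+^3. *)

Require Import Defs.
From HB Require Import structures.
From mathcomp Require Import all_boot all_order all_algebra.
From mathcomp Require Import all_classical all_reals all_analysis measurable_realfun ring lra.
Set Implicit Arguments.
Unset Strict Implicit.
Unset Printing Implicit Defensive.
Import Order.TTheory GRing.Theory Num.Theory.
Import numFieldNormedType.Exports.
Local Open Scope classical_set_scope.
Local Open Scope ring_scope.

(** * Lebesgue measure on R^n *)

(** The cutoffs vanish on the sphere together with their first and second derivatives, so Green's
    formula on a ball has no boundary term and reduces, through Fubini, to the one-variable fact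
    that a compactly supported derivative integrates to 0. The price is that the plain integral over
    the ball has to be recovered from the moments against powers of a cutoff. In [(u - u x) w] the
    point [x] is both the centre of the balls and a frozen argument of [u]. Shrinking the balls
    therefore gives information at the centre only; letting [x] run over [Omega] turns it into the
    identity Delta(uw) = u Delta w, which can then be used at every point of a ball with fixed
    centre. Smoothness of an analytic [w] rests on second-order Taylor bounds that are uniform over
    the partial sums, hence survive in the limit and identify its partial derivatives. *)

Section boxes.
Context {R : realType}.
Implicit Types n : nat.

Lemma ler_coord_norm n (x : 'rV[R]_n) i : `|x ord0 i| <= `|x|.
Proof.
rewrite [leRHS]/Num.Def.normr/= mx_normrE.
exact: (le_bigmax _ (fun i => `|x i.1 i.2|) (ord0, i)).
Qed.

Lemma rV_norm_le n (x : 'rV[R]_n) M : 0 <= M ->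
  (forall i, `|x ord0 i| <= M) -> `|x| <= M.
Proof.
move=> M0 xM; rewrite [leLHS]/Num.Def.normr/= mx_normrE.
by apply/bigmax_leP; split => // -[i j] _ /=; rewrite ord1.
Qed.

Lemma rV_norm_lt n (x : 'rV[R]_n) M : 0 < M ->
  (forall i, `|x ord0 i| < M) -> `|x| < M.
Proof.
move=> M0 xM; rewrite [ltLHS]/Num.Def.normr/= mx_normrE.
by apply/bigmax_ltP; split => // -[i j] _ /=; rewrite ord1.
Qed.

Definition box_rV n (A : 'I_n -> set R) : set 'rV[R]_n :=
  [set y | forall i, A i (y ord0 i)].

Lemma measurable_box_rV n (A : 'I_n -> set R) :
  (forall i, measurable (A i)) -> measurable (box_rV A).
Proof.
move=> mA; rewrite (_ : box_rV A = \bigcap_(i in [set: 'I_n])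
    [set y : 'rV[R]_n | A i (y ord0 i)]); last first.
  by apply/seteqP; split => y Ay i *; apply: Ay.
apply: fin_bigcap_measurable => // i _.
by rewrite -[X in measurable X]setTI; exact: measurable_coord_rV.
Qed.

(** The sigma-algebra is generated by the coordinates, so second countability is the point: an open
    set is the union of the countably many sup-norm boxes with rational centre and radius [1/(k+1)]
    that it contains. *)
Lemma open_measurable_rV n (A : set 'rV[R]_n) : open A -> measurable A.
Proof.
move=> oA.
pose F (p : 'rV[rat]_n * nat) := box_rV (fun i : 'I_n =>
  [set t : R | `|ratr (p.1 ord0 i) - t| < p.2.+1%:R^-1]).
have -> : A = \bigcup_(p in [set: 'rV[rat]_n * nat])
    (if `[< F p `<=` A >] then F p else set0).
  apply/seteqP; split=> [x Ax|x [p _]]; last by case: asboolP => // FA Fx; exact: FA.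
  have /nbhs_ballP[e /= e0 eA] : nbhs x A by exact: (open_nbhs_nbhs (conj oA Ax)).
  (* Half of [e]: the box contains [x] but is centred at a rational point, so its points are within
     two radii of [x]. *)
  have [k ke] : exists k, (k.+1%:R^-1 : R) < e / 2.
    have e20 : 0 < e / 2 by rewrite divr_gt0.
    by near \oo => k; exists k; near: k; exact: near_infty_natSinv_lt (PosNum e20).
  have k0 : 0 < (k.+1%:R^-1 : R) by rewrite invr_gt0.
  have /choice[c xc] : forall i, exists c : rat,
      ratr c \in `](x ord0 i), (x ord0 i + k.+1%:R^-1)[.
    by move=> i; apply: rat_in_itvoo; rewrite ltrDl.
  exists (\row_i c i, k) => //; case: asboolP => [_|[]].
    move=> i /=; rewrite mxE; have := xc i; rewrite in_itv/= => /andP[c1 c2].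
    by rewrite ger0_norm ?subr_ge0 1?ltW// ltrBlDl.
  move=> y Fy; apply: eA; split => // i j; rewrite !ord1{i}.
  have := Fy j; have := xc j; rewrite /= mxE in_itv/= => /andP[c1 c2] c3.
  rewrite -ball_normE /ball_/=.
  have := ler_distD (ratr (c j)) (x ord0 j) (y ord0 j) => /le_lt_trans; apply.
  rewrite (splitr e) ltrD ?(lt_trans c3)//.
  by rewrite distrC ger0_norm ?subr_ge0 1?ltW// ltrBlDl (lt_trans c2)// ltrD2l.
apply: countable_bigcupT_measurable => // p; case: ifP => // _.
apply: measurable_box_rV => i.
rewrite (_ : mkset _ = ball (ratr (p.1 ord0 i) : R) (p.2.+1%:R^-1)).
  by apply: open_measurable; exact: ball_open.
by rewrite -ball_normE.
Unshelve. all: by end_near. Qed.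

Lemma cons_rV_lift n (p : measurableTypeR R * 'rV[R]_n) j :
  cons_rV p ord0 (lift ord0 j) = p.2 ord0 j.
Proof. by rewrite mxE liftK. Qed.

Lemma cons_rV0 n (p : measurableTypeR R * 'rV[R]_n) : cons_rV p ord0 ord0 = p.1.
Proof. by rewrite mxE unlift_none. Qed.

Lemma borel_lebesgue_boxS n (A : 'I_n.+1 -> set R) :
  (forall i, measurable (A i)) ->
  borel_lebesgue_rV n.+1 (box_rV A) =
  (lebesgue_measure (A ord0) * borel_lebesgue_rV n (box_rV (fun i => A (lift ord0 i))))%E.
Proof.
move=> mA; rewrite -product_measure2E; [|exact: mA|exact: measurable_box_rV].
rewrite /= /lebesgue_prod_rV /pushforward; congr (_ _).
apply/seteqP; split=> [p Ap|p [p1 p2] i] /=.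
  split; first by rewrite -(cons_rV0 p); exact: Ap.
  by move=> i /=; rewrite -cons_rV_lift; exact: Ap.
by case: (unliftP ord0 i) => [j|] ->; rewrite ?cons_rV_lift ?cons_rV0//; exact: p2.
Qed.

Lemma borel_lebesgue_box0 (A : 'I_0 -> set R) :
  borel_lebesgue_rV 0 (box_rV A) = 1%E.
Proof.
by rewrite /= diracE mem_set// => -[].
Qed.

Lemma borel_lebesgue_box_lty n (A : 'I_n -> set R) :
  (forall i, measurable (A i)) -> (forall i, lebesgue_measure (A i) < +oo)%E ->
  (borel_lebesgue_rV n (box_rV A) < +oo)%E.
Proof.
elim: n A => [|n IH] A mA Aoo; first by rewrite borel_lebesgue_box0 ltry.
rewrite borel_lebesgue_boxS// lte_mul_pinfty ?ge0_fin_numE//.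
exact: IH.
Qed.

Lemma borel_lebesgue_box_gt0 n (A : 'I_n -> set R) :
  (forall i, measurable (A i)) -> (forall i, 0 < lebesgue_measure (A i))%E ->
  (0 < borel_lebesgue_rV n (box_rV A))%E.
Proof.
elim: n A => [|n IH] A mA A0; first by rewrite borel_lebesgue_box0.
by rewrite borel_lebesgue_boxS// mule_gt0//; exact: IH.
Qed.

Lemma borel_lebesgue_sigma_finite n :
  sigma_finite [set: 'rV[R]_n] (borel_lebesgue_rV n).
Proof.
exists (fun k => box_rV (fun=> `[- k%:R, k%:R]%classic)).
  apply/esym; apply/seteqP; split => // x _.
  exists (Num.truncn `|x|).+1 => // i /=.
  rewrite in_itv/= -ler_norml ltW//.
  apply: le_lt_trans (truncnS_gt _).
  exact: ler_coord_norm.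
move=> k; split; first exact: measurable_box_rV.
apply: borel_lebesgue_box_lty => // i; rewrite lebesgue_measure_itv/=.
by case: ifP; rewrite ?ltry// -EFinB ltry.
Qed.

(* [borel_lebesgue_rV n] is already a packed measure, so the sigma-finite instance
   needed for Fubini is declared on this copy. *)
Definition sf_lebesgue n : set 'rV[R]_n -> \bar R := borel_lebesgue_rV n.

HB.instance Definition _ n := Measure.on (@sf_lebesgue n).

HB.instance Definition _ n := @Measure_isSigmaFinite.Build _ _ _
  (@sf_lebesgue n) (@borel_lebesgue_sigma_finite n).

End boxes.

(** * The completed measure and its comparison with the Borel product measure *)

Section lebesgue_borel.
Context {R : realType}.
Implicit Types n : nat.

Lemma measurable_lebesgueType n (A : set 'rV[R]_n) :
  measurable A -> @measurable _ (lebesgueType R n) A.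
Proof. by move=> mA; apply: sub_caratheodory; exact: sub_sigma_algebra. Qed.

Lemma open_measurable_lebesgueType n (A : set 'rV[R]_n) :
  open A -> @measurable _ (lebesgueType R n) A.
Proof. by move=> oA; apply: measurable_lebesgueType; exact: open_measurable_rV. Qed.

Lemma lebesgue_rVE n (A : set 'rV[R]_n) :
  measurable A -> lebesgue_rV n A = borel_lebesgue_rV n A.
Proof. exact: measurable_mu_extE. Qed.

Lemma open_setI_preimage n (U : set 'rV[R]_n) (f : 'rV[R]_n -> R) B :
  open U -> (forall x, U x -> {for x, continuous f}) -> open B ->
  open (U `&` f @^-1` B).
Proof.
move=> oU cf oB; rewrite openE => x [Ux Bfx]; apply: filterI.
  exact: (open_nbhs_nbhs (conj oU Ux)).
exact: (cf _ Ux _ (open_nbhs_nbhs (conj oB Bfx))).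
Qed.

Lemma continuous_measurable_rV n (U : set 'rV[R]_n) (f : 'rV[R]_n -> R) :
  open U -> (forall x, U x -> {for x, continuous f}) -> measurable_fun U f.
Proof.
move=> oU cf; apply: (measurability _ (RGenOpens.measurableE R)).
move=> _ [_ [a [b ->] <-]]; apply: open_measurable_rV.
by apply: open_setI_preimage => //; exact: interval_open.
Qed.

Lemma continuous_measurable_lebesgueType n (U : set 'rV[R]_n) (f : 'rV[R]_n -> R) :
  open U -> (forall x, U x -> {for x, continuous f}) ->
  @measurable_fun _ _ (lebesgueType R n) R U f.
Proof.
move=> oU cf; apply: (measurability _ (RGenOpens.measurableE R)).
move=> _ [_ [a [b ->] <-]]; apply: open_measurable_lebesgueType.
by apply: open_setI_preimage => //; exact: interval_open.
Qed.

Lemma lebesgue_rV_bounded_lty n (A : set (lebesgueType R n)) (M : R) :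
  measurable A -> (forall x : 'rV[R]_n, A x -> `|x| <= M) -> (lebesgue_rV n A < +oo)%E.
Proof.
move=> mA AM.
have mB : measurable (box_rV (fun _ : 'I_n => `[-M, M]%classic)).
  by apply: measurable_box_rV.
apply: (@le_lt_trans _ _ (lebesgue_rV n (box_rV (fun _ : 'I_n => `[-M, M]%classic)))).
  apply: le_measure; rewrite ?inE//; first exact: measurable_lebesgueType.
  move=> x Ax i /=; rewrite in_itv/= -ler_norml.
  by rewrite (le_trans (ler_coord_norm _ _))// AM.
rewrite lebesgue_rVE// borel_lebesgue_box_lty// => i.
by rewrite lebesgue_measure_itv/=; case: ifP; rewrite ?ltry// -EFinB ltry.
Qed.

Lemma lebesgue_rV_open_gt0 n (A : set 'rV[R]_n) (x : 'rV[R]_n) :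
  open A -> A x -> (0 < lebesgue_rV n A)%E.
Proof.
move=> oA Ax; have /nbhs_ballP[e /= e0 eA] := open_nbhs_nbhs (conj oA Ax).
pose B := box_rV (fun i : 'I_n => `](x ord0 i - e), (x ord0 i + e)[%classic).
have mB : measurable B by apply: measurable_box_rV.
apply: (@lt_le_trans _ _ (lebesgue_rV n B)).
  rewrite lebesgue_rVE// borel_lebesgue_box_gt0// => i.
  rewrite lebesgue_measure_itv/= lte_fin ltrD2l gtrN//.
  by rewrite -EFinB lte_fin subr_gt0 ltrD2l gtrN.
apply: le_measure; rewrite ?inE//.
- exact: measurable_lebesgueType.
- exact: open_measurable_lebesgueType.
move=> y By; apply: eA; split => // i j; rewrite ord1 -ball_normE/=.
have := By j; rewrite /= in_itv/= => /andP[y1 y2].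
by rewrite distrC ltr_distl y1 y2.
Qed.


(** Fubini is applied to the product measure on Borel sets, whereas strong harmonicity integrates
    against its completion. On Borel sets the former is the image of the latter under the identity,
    so the integrals of a Borel function agree. *)
Lemma integral_lebesgue_borel n (f : 'rV[R]_n -> \bar R) :
  measurable_fun setT f -> (@lebesgue_rV R n).-integrable setT f ->
  (\int[lebesgue_rV n]_y f y = \int[borel_lebesgue_rV n]_y f y)%E.
Proof.
move=> mf intf.
have mid : measurable_fun setT (id : lebesgueType R n -> 'rV[R]_n).
  by move=> _ B mB; rewrite setTI; exact: measurable_lebesgueType.
transitivity (\int[pushforward (@lebesgue_rV R n)
    (id : lebesgueType R n -> 'rV[R]_n)]_y f y)%E.
  by rewrite integral_pushforward.
apply: eq_measure_integral => /= B mB _; exact: lebesgue_rVE.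
Qed.

Lemma integrable_bounded_supp d (T : measurableType d) (mu : {measure set T -> \bar R})
    (f : T -> R) (D : set T) (C : R) :
  measurable D -> (mu D < +oo)%E -> measurable_fun setT f ->
  (forall x, `|f x| <= C) -> (forall x, ~ D x -> f x = 0) ->
  mu.-integrable setT (EFin \o f).
Proof.
move=> mD muD mf fC f0.
have -> : EFin \o f = (EFin \o f) \_ D.
  apply/funext => x; rewrite patchE; case: ifPn => //.
  by rewrite notin_setE => /f0 /= ->.
apply: (integrable_mkcond _ mD).1; apply: measurable_bounded_integrable => //.
  exact: measurable_funTS.
exists C; split; first exact: num_real.
by move=> y Cy x _ /=; rewrite (le_trans (fC x))// ltW.
Qed.

Lemma continuous_bounded_on n (f : 'rV[R]_n -> R) (A : set 'rV[R]_n) :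
  compact A -> (forall x, A x -> {for x, continuous f}) ->
  exists C : R, forall x, A x -> `|f x| <= C.
Proof.
move=> cA cf.
have : compact (f @` A).
  apply: continuous_compact cA.
  apply: continuous_in_subspaceT => x; rewrite inE; exact: cf.
move=> /compact_bounded[C [_ CA]]; exists (C + 1) => x Ax.
by apply: CA; [rewrite ltrDl|exists x].
Qed.

Lemma compact_norm_le n (M : R) : compact [set x : 'rV[R]_n | `|x| <= M].
Proof.
apply: bounded_closed_compact.
  by exists M; split; [exact: num_real|move=> y My x /= /le_trans; apply; exact: ltW].
rewrite (_ : mkset _ = (fun x : 'rV[R]_n => `|x|) @^-1` [set r | r <= M])//.
apply: closed_comp; last exact: closed_le.
by move=> x _; exact: norm_continuous.
Qed.

Lemma continuous_bounded_supp n (f : 'rV[R]_n -> R) (M : R) :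
  continuous f -> (forall x, M < `|x| -> f x = 0) ->
  exists C : R, forall x, `|f x| <= C.
Proof.
move=> cf f0.
have [C CM] := continuous_bounded_on (@compact_norm_le n M) (fun x _ => cf x).
exists (Num.max C 0) => x; have [xM|Mx] := leP `|x| M; last first.
  by rewrite f0// normr0 le_max lexx orbT.
by rewrite le_max CM.
Qed.

End lebesgue_borel.

(** * Integrals of compactly supported derivatives *)

Section ibp.
Context {R : realType}.
Implicit Types n : nat.

(* A directional derivative only depends on the restriction to a line; this reduces
   shifts, sections and compositions to the one-variable calculus. *)
Lemma is_derive_line (V V' : normedModType R) (f : V -> R) (g : V' -> R)
    (a v : V) (b w : V') (df : R) :
  (forall h : R, f (h *: v + a) = g (h *: w + b)) ->
  is_derive a v f df -> is_derive b w g df.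
Proof.
move=> fg [dfa <-].
have E : (fun h => h^-1 *: ((g \o shift b) (h *: w) - g b)) =
         (fun h => h^-1 *: ((f \o shift a) (h *: v) - f a)).
  apply/funext => h /=; rewrite -fg; congr (_ *: (_ - _)).
  by have := fg 0; rewrite !scale0r !add0r.
by split; [rewrite /derivable E|rewrite /derive E].
Qed.

Lemma cons_rV_sub n (p q : measurableTypeR R * 'rV[R]_n) d : 0 < d ->
  `|p.1 - q.1 : R| < d -> `|p.2 - q.2| < d -> `|cons_rV p - cons_rV q| < d.
Proof.
move=> d0 d1 d2; apply: rV_norm_lt => // i.
have -> : (cons_rV p - cons_rV q) ord0 i = cons_rV p ord0 i - cons_rV q ord0 i.
  by rewrite mxE [X in _ + X]mxE.
case: (unliftP ord0 i) => [j|] ->; rewrite ?cons_rV_lift ?cons_rV0//.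
apply: le_lt_trans d2; have := ler_coord_norm (p.2 - q.2) j.
by rewrite mxE [X in _ + X]mxE.
Qed.

Lemma cons_rV_continuous1 n (y : 'rV[R]_n) :
  continuous (fun t : R => cons_rV (t, y) : 'rV[R]_n.+1).
Proof.
move=> t; apply/cvgrPdist_lt => e e0; near=> s.
apply: cons_rV_sub => //=; last by rewrite subrr normr0.
Unshelve. end_near. Qed.

Lemma cons_rV_continuous2 n (t : R) :
  continuous (fun y : 'rV[R]_n => cons_rV (t, y) : 'rV[R]_n.+1).
Proof.
move=> y; apply/(@cvgrPdist_lt _ _ _ (nbhs y) (nbhs_filter y)) => e e0; near=> s.
apply: cons_rV_sub => //=; first by rewrite subrr normr0.
Unshelve. end_near. Qed.

Lemma cons_rV_shift0 n (h t : R) (y : 'rV[R]_n) :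
  cons_rV (h *: 1 + t, y) = h *: delta_mx ord0 ord0 + cons_rV (t, y).
Proof.
apply/rowP => i; rewrite !mxE eqxx/=.
by case: (unliftP ord0 i) => [j|] ->; rewrite ?liftK ?unlift_none/= ?mulr0 ?mulr1 ?add0r// scaler1.
Qed.

Lemma cons_rV_shift n (h t : R) (y : 'rV[R]_n) j :
  cons_rV (t, h *: delta_mx ord0 j + y) =
  h *: delta_mx ord0 (lift ord0 j) + cons_rV (t, y).
Proof.
apply/rowP => i; rewrite !mxE eqxx/=.
case: (unliftP ord0 i) => [k|] ->; rewrite ?liftK ?unlift_none/= ?mulr0 ?add0r//.
by rewrite !mxE eqxx/= (inj_eq lift_inj).
Qed.

Lemma integral_derive_supp1 (F g : R -> R) (M : R) :
  (forall t : R, is_derive t (1 : R) F (g t)) -> continuous g ->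
  (forall t, M < `|t| -> F t = 0) -> (forall t, M < `|t| -> g t = 0) ->
  (\int[lebesgue_measure]_t (g t)%:E = 0)%E.
Proof.
move=> dF cg F0 g0.
(* [M] may be negative; [N] is positive and lies beyond [M], so [F] vanishes at both ends of
   [[-N, N]]. *)
pose N : R := `|M| + 1.
have MN : M < N by rewrite (le_lt_trans (ler_norm _))// ltrDl.
have N0 : 0 < N by rewrite ltr_wpDl.
transitivity (\int[lebesgue_measure]_(t in `[(- N)%R, N]) (g t)%:E)%E.
  rewrite [RHS]integral_mkcond; apply: eq_integral => t _.
  rewrite patchE; case: ifPn => //; rewrite notin_setE/= in_itv/= => /negP.
  by rewrite -ler_norml -ltNge => Nt; rewrite g0// (lt_trans MN).
have cF : continuous F.
  by move=> t; apply: differentiable_continuous; apply/derivable1_diffP; case: (dF t).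
rewrite (@continuous_FTC2 _ g F).
- by rewrite (F0 N) ?(F0 (- N)) ?normrN ?gtr0_norm// subee.
- by rewrite gtrN.
- exact: continuous_subspaceT.
- split; first by move=> t _; case: (dF t).
    by apply: cvg_at_right_filter; exact: cF.
  by apply: cvg_at_left_filter; exact: cF.
- by move=> t _; rewrite derive1E; case: (dF t).
Qed.

(** Induction on the dimension, splitting off the first coordinate. The order of integration is
    chosen so that the variable of differentiation belongs to the inner integral: that integral
    vanishes by induction for a later coordinate, and by [integral_derive_supp1] for the first
    one. *)
Lemma integral_derive_supp n (i : 'I_n) (F g : 'rV[R]_n -> R) (M : R) :
  (forall y, is_derive y (delta_mx ord0 i : 'rV[R]_n) F (g y)) -> continuous g ->
  (forall y, M < `|y| -> F y = 0) -> (forall y, M < `|y| -> g y = 0) ->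
  (\int[borel_lebesgue_rV n]_y (g y)%:E = 0)%E.
Proof.
elim: n i F g M => [[]//|n IH] i F g M dF cg F0 g0.
have mg : measurable_fun setT g.
  by apply: continuous_measurable_rV; [exact: openT|move=> x _; exact: cg].
have mgc : measurable_fun setT (g \o @cons_rV R n).
  exact: (measurableT_comp mg (@measurable_cons_rV R n)).
have [C gC] := continuous_bounded_supp cg g0.
have norm2 (t : R) (y : 'rV[R]_n) : M < `|y| -> M < `|cons_rV (t, y)|.
  move=> /lt_le_trans; apply; apply: rV_norm_le => // j.
  by rewrite -(cons_rV_lift (t, y)); exact: ler_coord_norm.
have norm1 (t : R) (y : 'rV[R]_n) : M < `|t| -> M < `|cons_rV (t, y)|.
  move=> /lt_le_trans; apply.
  by have := ler_coord_norm (cons_rV (t, y)) ord0; rewrite cons_rV0.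
(* A box of finite product measure outside which [g] vanishes; with the bound [C] it gives the
   integrability that Fubini requires. *)
pose D : set (measurableTypeR R * 'rV[R]_n) :=
  `[(- M), M]%classic `*` box_rV (fun=> `[(- M), M]%classic).
have mbox : measurable (box_rV (fun _ : 'I_n => `[(- M), M]%classic : set R)).
  by apply: measurable_box_rV.
have muI : (lebesgue_measure (`[(- M)%R, M]%classic : set R) < +oo)%E.
  by rewrite lebesgue_measure_itv/=; case: ifP; rewrite ?ltry// -EFinB ltry.
have supD p : ~ D p -> (g \o @cons_rV R n) p = 0.
  case: p => t y /= nD; apply: g0.
  rewrite ltNge; apply/negP => Mty; apply: nD; split => /=.
    rewrite in_itv/= -ler_norml (le_trans _ Mty)//.
    by have := ler_coord_norm (cons_rV (t, y)) ord0; rewrite cons_rV0.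
  move=> j /=; rewrite in_itv/= -ler_norml (le_trans _ Mty)//.
  by have := ler_coord_norm (cons_rV (t, y)) (lift ord0 j); rewrite cons_rV_lift.
have mI : measurable (`[(- M), M]%classic : set (measurableTypeR R)) by [].
have mD : measurable D by exact: measurableX.
have muD : (lebesgue_measure (`[(- M)%R, M]%classic : set R) *
    borel_lebesgue_rV n (box_rV (fun=> `[(- M)%R, M]%classic)) < +oo)%E.
  rewrite lte_mul_pinfty ?ge0_fin_numE//.
  by apply: borel_lebesgue_box_lty.
have intg1 : (lebesgue_measure \x (@sf_lebesgue R n))%E.-integrable setT
    (EFin \o (g \o @cons_rV R n)).
  apply: (@integrable_bounded_supp _ _ _ _ _ D C) => //.
    exact: (eq_ind_r (fun x => (x < +oo)%E) muD
      (product_measure1E lebesgue_measure (@sf_lebesgue R n) mI mbox)).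
  by move=> x /=; exact: gC.
have intg2 : (lebesgue_measure \x^ (borel_lebesgue_rV n))%E.-integrable setT
    (EFin \o (g \o @cons_rV R n)).
  apply: (@integrable_bounded_supp _ _ _ _ _ D C) => //.
    exact: (eq_ind_r (fun x => (x < +oo)%E) muD
      (product_measure2E lebesgue_measure (borel_lebesgue_rV n) mI mbox)).
  by move=> x /=; exact: gC.
have gcE : (\int[borel_lebesgue_rV n.+1]_y (g y)%:E =
    \int[(lebesgue_measure \x^ (@sf_lebesgue R n))]_p (g (cons_rV p))%:E)%E.
  rewrite /= /lebesgue_prod_rV.
  rewrite (@integral_pushforward _ _ _ _ _ _ (@measurable_cons_rV R n))//.
  exact/measurable_EFinP.
rewrite gcE.
have [j ij|i0] := unliftP ord0 i.
  rewrite -(integral12_prod_meas2 intg1) integral0_eq// => t _.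
  rewrite /fubini_F/=.
  apply: (IH j (fun y => F (cons_rV (t, y))) (fun y => g (cons_rV (t, y))) M).
  - move=> y; apply: is_derive_line (dF (cons_rV (t, y))) => h.
    by rewrite cons_rV_shift ij.
  - move=> y; apply: continuous_comp; [exact: cons_rV_continuous2|exact: cg].
  - by move=> y /norm2 My; exact: F0.
  - by move=> y /norm2 My; exact: g0.
rewrite -(integral21_prod_meas2 intg1) integral0_eq// => y _.
rewrite /fubini_G/=.
apply: (@integral_derive_supp1 (fun t => F (cons_rV (t, y))) (fun t => g (cons_rV (t, y))) M).
- move=> t; apply: is_derive_line (dF (cons_rV (t, y))) => h.
  by rewrite cons_rV_shift0 i0.
- move=> t; apply: continuous_comp; [exact: cons_rV_continuous1|exact: cg].
- by move=> t /norm1 My; exact: F0.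
- by move=> t /norm1 My; exact: g0.
Qed.
End ibp.

(** * Functions of class C^k *)

Section Ck.
Context {R : realType} {n : nat}.
Implicit Types (U V : set 'rV[R]_n) (f g : 'rV[R]_n -> R) (k : nat).

Local Notation e i := (delta_mx ord0 i : 'rV[R]_n).

(** Only coordinate derivatives are recorded, which is what [laplacian] is built from. Continuity is
    demanded at every level because the existence of partial derivatives does not imply it. *)
Fixpoint Ck k U f : Prop :=
  (forall x, U x -> {for x, continuous f}) /\
  if k is k'.+1 then
    forall i, (forall x, U x -> derivable f x (e i)) /\ Ck k' U ('D_(e i) f)
  else True.

Lemma Ck_continuous k U f x : Ck k U f -> U x -> {for x, continuous f}.
Proof. by case: k => [|k] [cf _]; exact: cf. Qed.

Lemma Ck_derivable k U f i x : Ck k.+1 U f -> U x -> derivable f x (e i).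
Proof. by move=> [_ /(_ i)[df _]]; exact: df. Qed.

Lemma Ck_D k U f i : Ck k.+1 U f -> Ck k U ('D_(e i) f).
Proof. by move=> [_ /(_ i)[]]. Qed.

Lemma CkS_Ck k U f : Ck k.+1 U f -> Ck k U f.
Proof.
elim: k f => [|k IH] f; first by move=> [cf _]; split.
move=> [cf df]; split => // i; have [d1 d2] := df i.
by split => //; exact: IH.
Qed.

Lemma Ck_le k m U f : (k <= m)%N -> Ck m U f -> Ck k U f.
Proof.
elim: m => [|m IH]; first by rewrite leqn0 => /eqP ->.
by rewrite leq_eqVlt => /predU1P[->//|km /CkS_Ck]; exact: IH.
Qed.

Lemma Ck_subset k U V f : V `<=` U -> Ck k U f -> Ck k V f.
Proof.
move=> VU; elim: k f => [|k IH] f [cf df].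
  by split=> // x /VU; exact: cf.
split=> [x /VU|i]; first exact: cf.
have [d1 d2] := df i; split; last exact: IH.
by move=> x /VU; exact: d1.
Qed.

Lemma Ck_eq k U f g : open U -> (forall x, U x -> f x = g x) ->
  Ck k U f -> Ck k U g.
Proof.
move=> oU; elim: k f g => [|k IH] f g fg [cf df].
  split => // x Ux; have nfg : {near x, f =1 g}.
    by apply: filterS (open_nbhs_nbhs (conj oU Ux)) => y; exact: fg.
  rewrite /prop_for /continuous_at -(fg x Ux).
  exact: cvg_trans (near_eq_cvg nfg) (cf x Ux).
have nfg x : U x -> {near x, f =1 g}.
  by move=> Ux; apply: filterS (open_nbhs_nbhs (conj oU Ux)) => y; exact: fg.
split => [x Ux|i].
  rewrite /prop_for /continuous_at -(fg x Ux).
  exact: cvg_trans (near_eq_cvg (nfg x Ux)) (cf x Ux).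
have [d1 d2] := df i; split.
  by move=> x Ux; apply: near_eq_derivable (nfg x Ux) _; exact: d1.
by apply: IH d2 => x Ux; apply: near_eq_derive; exact: (nfg x Ux).
Qed.

Lemma Ck_local k U f :
  (forall x, U x -> exists V, [/\ open V, V x & Ck k V f]) -> Ck k U f.
Proof.
elim: k f => [|k IH] f Uf.
  by split=> // x /Uf[V [_ Vx]] /Ck_continuous; exact.
split=> [x /Uf[V [_ Vx]] /Ck_continuous|i]; first exact.
split=> [x /Uf[V [_ Vx]] /Ck_derivable|]; first exact.
apply: IH => x /Uf[V [oV Vx] CV]; exists V; split => //; exact: Ck_D.
Qed.

Lemma Ck_cst k U (c : R) : Ck k U (fun=> c).
Proof.
elim: k c => [|k IH] c.
  by split => // x _; exact: cst_continuous.
split=> [x _|i]; first exact: cst_continuous.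
split=> [x _|]; first exact: (derivable_cst c).
rewrite (_ : 'D_(e i) _ = fun=> 0)//.
by apply/funext => x; exact: derive_cst.
Qed.

Lemma Ck_add k U f g : open U -> Ck k U f -> Ck k U g -> Ck k U (f \+ g).
Proof.
move=> oU; elim: k f g => [|k IH] f g Cf Cg.
  split => // x Ux.
  exact: cvgD (Ck_continuous Cf Ux) (Ck_continuous Cg Ux).
split=> [x Ux|i].
  exact: cvgD (Ck_continuous Cf Ux) (Ck_continuous Cg Ux).
have df x (Ux : U x) := Ck_derivable (i := i) Cf Ux.
have dg x (Ux : U x) := Ck_derivable (i := i) Cg Ux.
split=> [x Ux|]; first by apply: derivableD; [exact: df|exact: dg].
apply: Ck_eq (IH _ _ (Ck_D i Cf) (Ck_D i Cg)) => // x Ux /=.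
by rewrite deriveD//; [exact: df|exact: dg].
Qed.

Lemma Ck_mul k U f g : open U -> Ck k U f -> Ck k U g ->
  Ck k U (fun x => f x * g x).
Proof.
move=> oU; elim: k f g => [|k IH] f g Cf Cg.
  split => // x Ux.
  exact: cvgM (Ck_continuous Cf Ux) (Ck_continuous Cg Ux).
split=> [x Ux|i].
  exact: cvgM (Ck_continuous Cf Ux) (Ck_continuous Cg Ux).
have df x (Ux : U x) := Ck_derivable (i := i) Cf Ux.
have dg x (Ux : U x) := Ck_derivable (i := i) Cg Ux.
split=> [x Ux|]; first by apply: derivableM; [exact: df|exact: dg].
apply: Ck_eq (Ck_add oU (IH _ _ (CkS_Ck Cf) (Ck_D i Cg))
                        (IH _ _ (CkS_Ck Cg) (Ck_D i Cf))) => // x Ux /=.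
by rewrite deriveM//; [exact: df|exact: dg].
Qed.

Lemma Ck_scale k U (c : R) f : open U -> Ck k U f -> Ck k U (fun x => c * f x).
Proof. by move=> oU Cf; apply: Ck_mul => //; exact: Ck_cst. Qed.

Lemma Ck_sub k U f g : open U -> Ck k U f -> Ck k U g ->
  Ck k U (fun x => f x - g x).
Proof.
move=> oU Cf Cg; apply: Ck_eq (Ck_add oU Cf (Ck_scale (-1) oU Cg)) => // x _ /=.
by rewrite mulN1r.
Qed.

Lemma Ck_sum k U (I : Type) (r : seq I) (f : I -> 'rV[R]_n -> R) : open U ->
  (forall i, Ck k U (f i)) -> Ck k U (fun x => \sum_(i <- r) f i x).
Proof.
move=> oU Cf; elim: r => [|i r IH].
  by under eq_fun do rewrite big_nil; exact: Ck_cst.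
under eq_fun do rewrite big_cons.
exact: Ck_add.
Qed.

Lemma Ck_exp k U f m : open U -> Ck k U f -> Ck k U (fun x => f x ^+ m).
Proof.
move=> oU Cf; elim: m => [|m IH].
  by under eq_fun do rewrite expr0; exact: Ck_cst.
by under eq_fun do rewrite exprS; exact: Ck_mul.
Qed.

Lemma Ck_inv k U f : open U -> (forall x, U x -> f x != 0) -> Ck k U f ->
  Ck k U (fun x => (f x)^-1).
Proof.
move=> oU f0; elim: k => [|k IH] Cf.
  by split => // x Ux; exact: cvgV (f0 x Ux) (Ck_continuous Cf Ux).
split=> [x Ux|i].
  by exact: cvgV (f0 x Ux) (Ck_continuous Cf Ux).
have df x (Ux : U x) := Ck_derivable (i := i) Cf Ux.
split=> [x Ux|]; first by apply: derivableV; [exact: f0|exact: df].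
have C1 := IH (CkS_Ck Cf).
apply: Ck_eq (Ck_scale (-1) oU (Ck_mul oU (Ck_exp 2 oU C1) (Ck_D i Cf))) => // x Ux /=.
rewrite deriveV//; [|exact: f0|exact: df].
by rewrite mulN1r scaleNr exprVn.
Qed.

Lemma is_derive_coord (x : 'rV[R]_n) i j :
  is_derive x (e i) (fun y : 'rV[R]_n => y ord0 j) ((i == j)%:R).
Proof.
have := @is_derive_id R _ ((x ord0 j) : R) ((i == j)%:R : R).
apply: is_derive_line => h /=.
by rewrite !mxE eqxx/= eq_sym.
Qed.

Lemma Ck_coord k U j : Ck k U (fun y : 'rV[R]_n => y ord0 j).
Proof.
case: k => [|k].
  by split => // x _; exact: coord_continuous.
split=> [x _|i]; first exact: coord_continuous.
split=> [x _|]; first by case: (is_derive_coord x i j).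
rewrite (_ : 'D_(e i) _ = fun=> ((i == j)%:R : R)); first exact: Ck_cst.
by apply/funext => x; case: (is_derive_coord x i j).
Qed.

Lemma Ck_laplacian k U f : open U -> Ck k.+2 U f -> Ck k U (laplacian f).
Proof.
by move=> oU Cf; apply: Ck_sum => // i; do 2 apply: Ck_D.
Qed.

End Ck.

(** * Differentiation under the integral sign *)

Section kernel.
Context {R : realType} {n : nat}.
Local Notation e i := (delta_mx ord0 i : 'rV[R]_n).
Local Notation mu := (@lebesgue_rV R n).

Variables (U : set (lebesgueType R n)) (M : R) (f : 'rV[R]_n -> R).
Hypothesis mU : measurable U.
Hypothesis UM : forall y : 'rV[R]_n, U y -> `|y| <= M.
Hypothesis intf : mu.-integrable U (EFin \o f).

(** The convolution of [kappa] with [f] restricted to [U]; the fixed domain leaves all dependence on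
    [x] in the kernel. *)
Definition kernel_integral (kappa : 'rV[R]_n -> R) (x : 'rV[R]_n) : R :=
  \int[mu]_(y in U) (kappa (x - y) * f y).

Lemma kernel_measurable (kappa : 'rV[R]_n -> R) x : continuous kappa ->
  measurable_fun U (fun y : lebesgueType R n => kappa (x - y)).
Proof.
move=> ck; apply: (measurable_funS measurableT (@subsetT _ U)).
apply: continuous_measurable_lebesgueType => [|y _]; first exact: openT.
apply: continuous_comp; last exact: ck.
exact: cvgB (@cvg_cst _ _ _ _ _) (@cvg_id _ _).
Qed.

Lemma kernel_bounded (kappa : 'rV[R]_n -> R) (N : R) : continuous kappa ->
  exists C : R, forall x y : 'rV[R]_n, `|x| <= N -> U y -> `|kappa (x - y)| <= C.
Proof.
move=> ck.
have [C CM] := continuous_bounded_on (@compact_norm_le R n (N + M)) (fun x _ => ck x).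
exists C => x y xN Uy; apply: CM => /=.
by rewrite (le_trans (ler_normB _ _))// lerD// UM.
Qed.

Lemma kernel_integrable (kappa : 'rV[R]_n -> R) x : continuous kappa ->
  mu.-integrable U (EFin \o (fun y => kappa (x - y) * f y)).
Proof.
move=> ck; have [C CM] := kernel_bounded `|x| ck.
rewrite (_ : _ \o _ = (EFin \o (fun y : 'rV[R]_n => kappa (x - y)%R)) \* (EFin \o f))%E//.
apply: integrableMr => //; first exact: kernel_measurable.
exists C; split; first exact: num_real.
by move=> y Cy z Uz /=; rewrite (le_trans (CM _ _ _ Uz))// ltW.
Qed.

Lemma kernel_continuous (kappa : 'rV[R]_n -> R) : continuous kappa ->
  continuous (kernel_integral kappa).
Proof.
move=> ck x.
apply/(@cvgrPdist_le _ _ _ (nbhs x) (nbhs_filter x)) => eps eps0.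
pose S := \int[mu]_(y in U) `|f y|.
have S0 : 0 <= S by apply: Rintegral_ge0 => y _.
have S1 : 0 < S + 1 by rewrite ltr_wpDl.
pose d : R := eps / (S + 1).
have d0 : 0 < d by rewrite divr_gt0.
(* Continuity of [kappa] made uniform over a compact set containing all the differences [x - y], by
   the near-covering form of compactness. *)
have near_d : \forall x' \near x, [set z : 'rV[R]_n | `|z| <= `|x| + M] `<=`
    [set z | `|kappa z - kappa (z + (x' - x))| < d].
  have /compact_near_coveringP := @compact_norm_le R n (`|x| + M).
  move=> /(_ _ (nbhs x) (fun x' => [set z | `|kappa z - kappa (z + (x' - x))| < d])).
  apply => z0 _.
  have h1 : kappa p.1 @[p --> (z0, x)] --> kappa z0.
    by apply: continuous_cvg; [exact: ck|exact: cvg_fst].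
  have h2 : kappa (p.1 + (p.2 - x)) @[p --> (z0, x)] --> kappa z0.
    have E : z0 + (x - x) = z0 by rewrite subrr addr0.
    rewrite -[X in _ --> kappa X]E.
    apply: continuous_cvg; first exact: ck.
    apply: cvgD; first exact: cvg_fst.
    by apply: cvgB; [exact: cvg_snd|exact: cvg_cst].
  have := cvgB h1 h2; rewrite subrr => H.
  have H' : \forall p \near (z0, x), `|kappa p.1 - kappa (p.1 + (p.2 - x))| < d.
    have := (@cvgrPdist_lt _ R _ (nbhs (z0, x)) (nbhs_filter _) _ _).1 (H (nbhs_filter _)) d d0.
    by apply: filterS => p; rewrite sub0r normrN.
  exact: H'.
near=> x'.
have near_x' : [set z : 'rV[R]_n | `|z| <= `|x| + M] `<=`
    [set z | `|kappa z - kappa (z + (x' - x))| < d] by near: x'.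
rewrite /kernel_integral -RintegralB//; [|exact: kernel_integrable..].
have intB : mu.-integrable U
    (EFin \o (fun y => kappa (x - y) * f y - kappa (x' - y) * f y)).
  rewrite (_ : _ \o _ = (EFin \o (fun y : 'rV[R]_n => (kappa (x - y) * f y)%R)) \-
    (EFin \o (fun y : 'rV[R]_n => (kappa (x' - y) * f y)%R)))%E//.
  by apply: integrableB => //; exact: kernel_integrable.
rewrite (le_trans (le_normr_Rintegral _ intB))//.
have intaf : mu.-integrable U (EFin \o (fun y => `|f y|)) by exact: (integrable_abse intf).
apply: (@le_trans _ _ (\int[mu]_(y in U) (d * `|f y|))).
  apply: le_Rintegral => //.
  - exact: (integrable_abse intB).
  - rewrite (_ : _ \o _ = (fun y => d%:E * (`|f y|%:E)))%E//.
    exact: integrableZl.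
  move=> y Uy; rewrite -mulrBl normrM ler_wpM2r//.
  have := near_x' (x - y); rewrite /= [x - y + _]addrC addrA subrK => H.
  by apply/ltW/H; rewrite (le_trans (ler_normB _ _))// lerD2l; exact: UM.
rewrite RintegralZl// -/S /d mulrAC ler_pdivrMr// ler_pM2l// lerDl.
done.
Unshelve. all: by end_near. Qed.

(** On the line through [x] in direction [e i] this is differentiation under the integral with
    respect to a real parameter, dominated by a multiple of [|f|]. *)
Lemma kernel_is_derive (kappa : 'rV[R]_n -> R) i x : Ck 1 setT kappa ->
  is_derive x (e i) (kernel_integral kappa) (kernel_integral ('D_(e i) kappa) x).
Proof.
move=> C1.
have ck : continuous kappa by move=> y; exact: (Ck_continuous C1).
have cdk : continuous ('D_(e i) kappa).
  by move=> y; exact: (Ck_continuous (Ck_D i C1)).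
(* The parameter [t] stays in [(-1, 1)], so the points [t *: e i + x] have norm at most
   [1 + |x|]. *)
have [C CM] := kernel_bounded (1 + `|x|) cdk.
pose F (t : R) (y : lebesgueType R n) := kappa (t *: e i + x - y) * f y.
have dF (t : R) (y : 'rV[R]_n) :
    is_derive t (1 : R) (F ^~ y) ('D_(e i) kappa (t *: e i + x - y) * f y).
  apply: (@is_derive_line _ _ _ (fun z => kappa z * f y) (F ^~ y) (t *: e i + x - y) (e i)).
    by move=> h; rewrite /F [h *: (1 : R)]mulr1 scalerDl !addrA.
  apply: (@is_derive_eq _ _ _ _ _ _ _ (f y *: 'D_(e i) kappa (t *: e i + x - y)));
    last by rewrite mulrC.
  rewrite (_ : (fun z => kappa z * f y) = f y \*: kappa); last first.
    by apply/funext => z /=; rewrite mulrC.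
  apply: is_deriveZ; apply: derivableP; exact: (Ck_derivable C1).
have partialE t y : partial1of2 F t y = 'D_(e i) kappa (t *: e i + x - y) * f y.
  by rewrite partial1of2E; case: (dF t y).
have I0 : `]((-1) : R), 1[%classic 0 by rewrite /= in_itv/= ltrN10 ltr01.
have intF (t : R) : `](-1), 1[%classic t -> mu.-integrable U (EFin \o F t).
  by move=> _; exact: kernel_integrable.
have derF (t : R) y : `](-1), 1[%classic t -> U y -> derivable (F ^~ y) t 1.
  by move=> _ _; case: (dF t y).
have G0 (y : lebesgueType R n) : 0 <= `|C| * `|f y| by rewrite mulr_ge0.
have intG : mu.-integrable U (EFin \o (fun y => `|C| * `|f y|)).
  rewrite (_ : _ \o _ = (fun y => `|C|%:E * (`|f y|%:E)))%E//.
  apply: integrableZl => //.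
  exact: (integrable_abse intf).
have GF (t : R) y : `](-1), 1[%classic t -> U y -> `|partial1of2 F t y| <= `|C| * `|f y|.
  rewrite /= in_itv/= => /andP[t1 t2] Uy.
  rewrite partialE normrM ler_wpM2r// (le_trans (CM _ _ _ Uy)) ?ler_norm//.
  rewrite (le_trans (ler_normD _ _))// lerD2r normrZ.
  rewrite -[leRHS]mulr1 ler_pM//; first by rewrite ler_norml !ltW.
  apply: rV_norm_le => // j; rewrite !mxE eqxx/=; by case: eqP; rewrite ?normr0 ?normr1.
have d1 := derivable_under_integral mU I0 intF derF G0 intG GF.
have d2 := differentiation_under_integral mU I0 intF derF G0 intG GF.
have d3 : is_derive (0 : R) (1 : R) (fun t => \int[mu]_(y in U) F t y)
    (kernel_integral ('D_(e i) kappa) x).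
  split => //; rewrite -derive1E d2; apply: eq_Rintegral => y _.
  by rewrite partialE scale0r add0r.
apply: is_derive_line d3 => h.
by rewrite [h *: (1 : R)]mulr1 addr0.
Qed.

Lemma Ck_kernel_integral k (kappa : 'rV[R]_n -> R) : Ck k setT kappa ->
  Ck k setT (kernel_integral kappa).
Proof.
elim: k kappa => [|k IH] kappa Ckk.
  split => // x _; apply: kernel_continuous => y; exact: (Ck_continuous Ckk).
split=> [x _|i].
  by apply: kernel_continuous => y; exact: (Ck_continuous Ckk).
have C1 : Ck 1 setT kappa by apply: Ck_le Ckk.
split=> [x _|]; first by case: (kernel_is_derive i x C1).
apply: Ck_eq (IH _ (Ck_D i Ckk)); first exact: openT.
by move=> x _; case: (kernel_is_derive i x C1).
Qed.

End kernel.

(** * Functions with vanishing integral over concentric balls *)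

Section sublevel.
Context d (T : measurableType d) (R : realType) (mu : {measure set T -> \bar R}).
Variable phi : T -> R.
Hypothesis mphi : measurable_fun setT phi.
Hypothesis phi0 : forall y, 0 <= phi y.

Let B s : set T := [set y | phi y < s].

(** Vanishing is asked at every level up to [r], so that [h] also integrates to 0 over the annuli
    between two levels. *)
Definition null_on_sublevels r (h : T -> R) :=
  mu.-integrable (B r) (EFin \o h) /\
  forall s, 0 < s <= r -> \int[mu]_(y in B s) h y = 0.

Lemma measurable_sublevel s : measurable (B s).
Proof.
rewrite -[B s]setTI.
have := mphi measurableT (measurable_itv `]-oo, s[); rewrite /preimage/=.
by under eq_set do rewrite in_itv/=.
Qed.

Lemma sublevel0 : B 0 = set0.
Proof. by apply/seteqP; split => // y; rewrite /B/= ltNge phi0. Qed.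

(* On the annulus [u <= phi < u + r/N] replacing [phi h] by [(phi - u) h] does not
   change the integral, and makes it at most [r/N] times that of [`|h|]. *)
Lemma null_on_sublevels_mulr r (h : T -> R) :
  null_on_sublevels r h -> null_on_sublevels r (fun y => phi y * h y).
Proof.
move=> [inth h0].
have mB := measurable_sublevel.
have intph : mu.-integrable (B r) (EFin \o (fun y => phi y * h y)).
  rewrite (_ : _ \o _ = (EFin \o phi) \* (EFin \o h))%E//.
  apply: integrableMr => //; first exact: measurable_funTS.
  exists r; split; first exact: num_real.
  move=> y ry z Bz /=; rewrite ger0_norm//; apply/ltW; exact: lt_trans ry.
split=> // s /andP[s0 sr].
have intah : mu.-integrable (B r) (EFin \o (fun y => `|h y|)) by exact: (integrable_abse inth).
have subB t t' : t <= t' -> B t `<=` B t'.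
  by move=> tt' y /= /lt_le_trans; apply.
(* Adds up the annulus bounds by induction on the number [k] of annuli of width [s/(N+1)], starting
   from the empty sublevel set. *)
have key (N k : nat) : (k <= N.+1)%N ->
    `|\int[mu]_(y in B (k%:R * (s / N.+1%:R))) (phi y * h y)| <=
    s / N.+1%:R * \int[mu]_(y in B (k%:R * (s / N.+1%:R))) `|h y|.
  elim: k => [_|k IH kN].
    by rewrite mul0r sublevel0 !Rintegral_set0 normr0 mulr0.
  set st := s / N.+1%:R in IH *.
  set u := k%:R * _ in IH *; set v := k.+1%:R * _.
  have st0 : 0 < st by rewrite divr_gt0.
  have u0 : 0 <= u by rewrite mulr_ge0// ltW.
  have vu : v = u + st by rewrite /v /u -/st -natr1 mulrDl mul1r.
  have vr : v <= r.
    rewrite (le_trans _ sr)// /v mulrCA ger_pMr// ler_pdivrMr// mul1r ler_nat//.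
  have uv : u <= v by rewrite vu lerDl ltW.
  have ur := le_trans uv vr.
  pose A := B v `\` B u.
  have mA : measurable A by exact: measurableD.
  have BvE : B v = B u `|` A by rewrite /A setDUK//; exact: subB.
  have dA : [disjoint B u & A].
    by apply/disj_setPS => y [? []].
  have intS (g : T -> R) D : measurable D -> D `<=` B r -> mu.-integrable (B r) (EFin \o g) ->
      mu.-integrable D (EFin \o g).
    by move=> mD DB; exact: integrableS.
  have AB : A `<=` B r by apply: subset_trans (subB _ _ vr); exact: subDsetl.
  have BvB := subB _ _ vr; have BuB := subB _ _ ur.
  have split (g : T -> R) : mu.-integrable (B r) (EFin \o g) ->
      \int[mu]_(y in B v) g y = \int[mu]_(y in B u) g y + \int[mu]_(y in A) g y.
    move=> ig; rewrite BvE Rintegral_setU//.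
    by apply: intS ig; [exact: measurableU|rewrite -BvE].
  have hA : \int[mu]_(y in A) h y = 0.
    have := split h inth.
    have v0 : 0 < v by rewrite vu ltr_wpDl.
    rewrite h0 ?v0//.
    (* For the innermost annulus [B u] is empty, a case that the condition [0 < s] in the hypothesis
       leaves out. *)
    have [->|ku] := eqVneq u 0.
      by rewrite sublevel0 Rintegral_set0 add0r.
    by rewrite h0 ?add0r// ur andbT lt_neqAle eq_sym ku.
  rewrite !split//.
  rewrite mulrDr (le_trans (ler_normD _ _))// lerD//; first by apply: IH; rewrite ltnW.
  have -> : \int[mu]_(y in A) (phi y * h y) = \int[mu]_(y in A) ((phi y - u) * h y).
    under [RHS]eq_Rintegral do rewrite mulrBl.
    rewrite RintegralB//; [|exact: intS|].
      by rewrite RintegralZl ?hA ?mulr0 ?subr0//; exact: intS.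
    rewrite (_ : _ \o _ = (fun y => u%:E * (h y)%:E))%E//.
    by apply: integrableZl => //; exact: intS.
  have intphu : mu.-integrable A (EFin \o (fun y => (phi y - u) * h y)).
    rewrite (_ : _ \o _ = (EFin \o (fun y => (phi y * h y)%R)) \-
        (fun y => u%:E * (h y)%:E))%E; last first.
      by apply/funext => y /=; rewrite mulrBl.
    apply: integrableB => //; first exact: intS.
    by apply: integrableZl => //; exact: intS.
  rewrite (le_trans (le_normr_Rintegral _ intphu))//.
  rewrite -RintegralZl//; last exact: intS.
  apply: le_Rintegral => //.
  - exact: (integrable_abse intphu).
  - rewrite (_ : _ \o _ = (fun y => st%:E * `|h y|%:E))%E//.
    by apply: integrableZl => //; exact: intS.
  move=> y [Bvy /negP]; rewrite -leNgt => uy.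
  rewrite normrM ler_wpM2r// ger0_norm ?subr_ge0// lerBlDl -vu ltW//.
have {}key (N : nat) : `|\int[mu]_(y in B s) (phi y * h y)| <=
    s / N.+1%:R * \int[mu]_(y in B s) `|h y|.
  have := key N N.+1 (leqnn _).
  by rewrite [_.+1%:R * _]mulrC divfK.
apply/eqP; rewrite -normr_le0; apply/ler_addgt0Pl => eps eps0; rewrite addr0.
set S := \int[mu]_(y in B s) `|h y| in key.
have S0 : 0 <= S by apply: Rintegral_ge0.
have [N HN] : exists N : nat, s * S / eps < N.+1%:R.
  by exists (Num.truncn (s * S / eps)); exact: truncnS_gt.
rewrite (le_trans (key N))// mulrAC ler_pdivrMr// [eps * _]mulrC -ler_pdivrMr//.
exact: ltW.
Qed.

Lemma null_on_sublevels_eq r (h h' : T -> R) : h =1 h' ->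
  null_on_sublevels r h -> null_on_sublevels r h'.
Proof. by move=> /funext ->. Qed.

Lemma null_on_sublevelsD r (h h' : T -> R) :
  null_on_sublevels r h -> null_on_sublevels r h' ->
  null_on_sublevels r (fun y => h y + h' y).
Proof.
move=> [ih h0] [ih' h'0]; split.
  rewrite (_ : _ \o _ = (EFin \o h) \+ (EFin \o h'))%E//.
  by apply: integrableD => //; exact: measurable_sublevel.
move=> s sr; have mB := measurable_sublevel.
have BsBr : B s `<=` B r.
  by move=> y /= /lt_le_trans; apply; case/andP: sr.
rewrite RintegralD//; [|exact: integrableS ih|exact: integrableS ih'].
by rewrite h0// h'0// addr0.
Qed.

Lemma null_on_sublevelsZ r (c : R) (h : T -> R) :
  null_on_sublevels r h -> null_on_sublevels r (fun y => c * h y).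
Proof.
move=> [ih h0]; split.
  rewrite (_ : _ \o _ = (fun y => c%:E * (h y)%:E))%E//.
  by apply: integrableZl => //; exact: measurable_sublevel.
move=> s sr; have mB := measurable_sublevel.
have BsBr : B s `<=` B r.
  by move=> y /= /lt_le_trans; apply; case/andP: sr.
by rewrite RintegralZl//; [rewrite h0// mulr0|exact: integrableS ih].
Qed.

Lemma null_on_sublevels_poly r (p : {poly R}) (h : T -> R) :
  null_on_sublevels r h -> null_on_sublevels r (fun y => p.[phi y] * h y).
Proof.
move=> nh; elim/poly_ind: p => [|p c IH].
  have := null_on_sublevelsZ 0 nh; apply: null_on_sublevels_eq => y.
  by rewrite hornerC.
have := null_on_sublevelsD (null_on_sublevels_mulr IH) (null_on_sublevelsZ c nh).
by apply: null_on_sublevels_eq => y; rewrite hornerMXaddC; ring.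
Qed.

End sublevel.

(** * Radial cutoffs and Green's formula *)

Section geometry.
Context {R : realType} {n : nat}.
Implicit Types (x y : 'rV[R]_n).

Definition sqd x y : R := \sum_(i < n) (x ord0 i - y ord0 i) ^+ 2.

Lemma sqd_ge0 x y : 0 <= sqd x y.
Proof. by apply: sumr_ge0 => i _; exact: sqr_ge0. Qed.

Lemma l2dist_ge0 x y : 0 <= l2dist x y.
Proof. exact: sqrtr_ge0. Qed.

Lemma sqr_l2dist x y : l2dist x y ^+ 2 = sqd x y.
Proof. by rewrite sqr_sqrtr// sqd_ge0. Qed.

Lemma l2dist_xx x : l2dist x x = 0.
Proof. by rewrite /l2dist big1 ?sqrtr0// => i _; rewrite subrr expr0n. Qed.

Lemma norm_le_l2dist x y : `|x - y| <= l2dist x y.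
Proof.
apply: rV_norm_le => [|i]; first exact: l2dist_ge0.
rewrite -(@ler_pXn2r _ 2)// ?nnegrE ?l2dist_ge0// sqr_l2dist real_normK ?num_real//.
rewrite mxE [X in _ + X]mxE /sqd (bigD1 i)//= lerDl.
by apply: sumr_ge0 => j _; exact: sqr_ge0.
Qed.

Lemma Ck_sqd k x : Ck k setT (sqd x).
Proof.
apply: Ck_sum => [|i]; first exact: openT.
apply: Ck_exp; first exact: openT.
by apply: Ck_sub; [exact: openT|exact: Ck_cst|exact: Ck_coord].
Qed.

Lemma l2dist_continuous x : continuous (l2dist x).
Proof.
move=> y; apply: (@continuous_comp _ _ _ (sqd x) Num.sqrt).
  exact: (Ck_continuous (Ck_sqd 0 x)).
exact: sqrt_continuous.
Qed.

Lemma l2ball_open x r : open (l2ball x r).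
Proof.
rewrite (_ : l2ball x r = l2dist x @^-1` [set t | t < r])//.
by apply: open_comp; [move=> y _; exact: l2dist_continuous|exact: open_lt].
Qed.

Lemma l2ball_center x (r : R) : 0 < r -> l2ball x r x.
Proof. by rewrite /l2ball/= l2dist_xx. Qed.

Lemma closure_l2ball x (r : R) : closure (l2ball x r) `<=` [set y | l2dist x y <= r].
Proof.
have : closed [set y | l2dist x y <= r].
  rewrite (_ : mkset _ = l2dist x @^-1` [set t | t <= r])//.
  apply: closed_comp; last exact: closed_le.
  by move=> y _; exact: l2dist_continuous.
move=> /closure_id ->; apply: closure_subset => y /=; exact: ltW.
Qed.

(** Neighbourhoods come as sup-norm balls, and a Euclidean ball lies in the sup-norm ball of the
    same radius. *)
Lemma compactly_contained_l2ball x (r : R) (Omega : set 'rV[R]_n) :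
  (forall y, `|x - y| <= r -> Omega y) -> compactly_contained (l2ball x r) Omega.
Proof.
move=> rO; split.
  apply: bounded_closed_compact; last exact: closed_closure.
  exists (`|x| + r); split; first exact: num_real.
  move=> M xrM y /closure_l2ball /= xy.
  rewrite (le_trans _ (ltW xrM))// -[y](subrK x) addrC (le_trans (ler_normD _ _))//.
  by rewrite lerD2l distrC (le_trans (norm_le_l2dist _ _)).
move=> y /closure_l2ball /= xy; apply: rO; exact: le_trans (norm_le_l2dist _ _) xy.
Qed.

Lemma compactly_contained_sub (A B Omega : set 'rV[R]_n) : A `<=` B ->
  compactly_contained B Omega -> compactly_contained A Omega.
Proof.
move=> AB [cB BO]; have AB' := closure_subset AB; split.
  by apply: subclosed_compact cB AB'; exact: closed_closure.
exact: subset_trans AB' BO.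
Qed.

End geometry.

(** * Powers of the positive part and the radial cutoffs *)

Section cutoff.
Context {R : realType} {n : nat}.
Local Notation e i := (delta_mx ord0 i : 'rV[R]_n).

Definition pospart (t : R) : R := Num.max t 0.

(** An exponent of at least 2 smooths the kink at 0: there the difference quotient is 0 on the left
    and [h ^+ m.+1] on the right, and both tend to 0. *)
Lemma is_derive_pospartX m (t : R) :
  is_derive t (1 : R) (fun s => pospart s ^+ m.+2) (m.+2%:R * pospart t ^+ m.+1).
Proof.
have [t0|t0|->] := ltgtP t 0.
- apply: (@near_eq_is_derive _ _ _ (cst 0)); last first.
    rewrite /pospart max_r 1?ltW// expr0n mulr0; exact: is_derive_cst.
  near=> s; rewrite /pospart max_r ?expr0n//.
  by apply/ltW; near: s; exact: lt_nbhsl.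
- apply: (@near_eq_is_derive R R^o R^o (fun s : R => s ^+ m.+2)); last first.
    rewrite /pospart max_l 1?ltW//.
    split; first exact: exprn_derivable.
    by rewrite exp_derive scaler_nat mulr_natl scaler1.
  near=> s; rewrite /pospart max_l//.
  by apply/ltW; near: s; exact: lt_nbhsr.
rewrite /pospart maxxx expr0n mulr0.
have E : h^-1 *: (((fun s : R => Num.max s 0 ^+ m.+2) \o shift 0) (h *: (1 : R)) -
    Num.max 0 0 ^+ m.+2) @[h --> (0 : R)^'] --> (0 : R).
  apply/cvgrPdist_lt => eps eps0; near=> h.
  rewrite /= addr0 maxxx expr0n subr0 sub0r normrN [h *: _]mulr1.
  have [h0|h0] := leP h 0; first by rewrite expr0n scaler0 normr0.
  rewrite exprS scalerA mulVf ?gt_eqF// scale1r.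
  rewrite ger0_norm ?exprn_ge0 1?ltW// exprS.
  have hn : `|h| = h by rewrite gtr0_norm.
  have heps : h < eps by rewrite -hn; near: h; exact: dnbhs0_lt.
  have h1 : h < 1 by rewrite -hn; near: h; exact: dnbhs0_lt.
  by rewrite (le_lt_trans _ heps)// ger_pMr// exprn_ile1// ltW.
split; first by apply/cvg_ex; exists 0.
exact: cvg_lim E.
Unshelve. all: by end_near. Qed.

(** The one-variable chain rule on the line through [x]; [q] is only asked to have a derivative in
    the direction [v]. *)
Lemma is_derive_comp_line (F q : 'rV[R]_n -> R) (g : R -> R) (x v : 'rV[R]_n) (a b : R) :
  (forall y, F y = g (q y)) ->
  is_derive (q x) (1 : R) g a -> is_derive x v q b -> is_derive x v F (a * b).
Proof.
move=> Fgq dg dq.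
have dq' : is_derive (0 : R) (1 : R) (fun h : R => q (h *: v + x)) b.
  by apply: is_derive_line dq => h; rewrite [h *: (1 : R)]mulr1 addr0.
have dF : is_derive (0 : R) (1 : R) (fun h : R => F (h *: v + x)) (a * b).
  rewrite (_ : (fun _ => _) = g \o (fun h : R => q (h *: v + x))); last exact/funext.
  by apply: is_derive1_comp; rewrite scale0r add0r.
by apply: is_derive_line dF => h; rewrite [h *: (1 : R)]mulr1 addr0.
Qed.

Lemma is_derive_pospart_comp m (q : 'rV[R]_n -> R) x i : Ck 1 setT q ->
  is_derive x (e i) (fun y => pospart (q y) ^+ m.+2)
    (m.+2%:R * pospart (q x) ^+ m.+1 * 'D_(e i) q x).
Proof.
move=> Cq; apply: is_derive_comp_line (is_derive_pospartX m (q x)) _ => //.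
by apply: derivableP; exact: (Ck_derivable Cq).
Qed.

Lemma pospart_continuous : continuous pospart.
Proof. by move=> t; apply: continuous_max; [exact: cvg_id|exact: cvg_cst]. Qed.

(** Each derivative costs one power of the positive part, and one power must remain for
    continuity. *)
Lemma Ck_pospart_comp m k (q : 'rV[R]_n -> R) : (k <= m)%N -> Ck k setT q ->
  Ck k setT (fun y => pospart (q y) ^+ m.+1).
Proof.
have cont m' j (p : 'rV[R]_n -> R) : Ck j setT p ->
    continuous (fun y => pospart (p y) ^+ m'.+1).
  move=> Cp y; apply: (@continuous_comp _ _ _ (pospart \o p) (fun t => t ^+ m'.+1)).
    by apply: continuous_comp; [exact: (Ck_continuous Cp)|exact: pospart_continuous].
  exact: exprn_continuous.
elim: k m => [|k IH] m km Cq.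
  by split=> // x _; exact: cont Cq x.
split=> [x _|i]; first exact: cont Cq x.
case: m km => // m km.
have C1 : Ck 1 setT q by exact: Ck_le Cq.
have D x := is_derive_pospart_comp m x i C1.
split=> [x _|]; first by case: (D x).
rewrite (_ : 'D_(e i) _ = fun x => m.+2%:R * pospart (q x) ^+ m.+1 * 'D_(e i) q x).
  apply: Ck_mul; [exact: openT| |exact: Ck_D Cq].
  by apply: Ck_scale; [exact: openT|apply: IH => //; exact: CkS_Ck].
by apply/funext => x; case: (D x).
Qed.

Definition cutoff (r : R) x m : 'rV[R]_n -> R :=
  fun y => pospart (r ^+ 2 - sqd x y) ^+ m.

Lemma Ck_quadric k (r : R) x : Ck k setT (fun y => r ^+ 2 - @sqd R n x y).
Proof. by apply: Ck_sub; [exact: openT|exact: Ck_cst|exact: Ck_sqd]. Qed.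

Lemma Ck_cutoff k (r : R) x m : (k <= m)%N -> Ck k setT (cutoff r x m.+1).
Proof. by move=> km; apply: Ck_pospart_comp => //; exact: Ck_quadric. Qed.

Lemma is_derive_quadric (r : R) x y i :
  is_derive y (e i) (fun y => r ^+ 2 - sqd x y) (2 * (x ord0 i - y ord0 i)).
Proof.
pose a : R := x ord0 i - y ord0 i.
(* The restriction of the quadric to the line [h *: e i + y], where only the [i]-th square changes,
   from [a ^+ 2] to [(a - h) ^+ 2]. *)
pose p : {poly R} := (r ^+ 2 - sqd x y)%:P + (2 * a)%:P * 'X - 'X^2.
have d : is_derive (0 : R) (1 : R) (horner p) (2 * a).
  apply: is_derive_eq (is_derive_poly p 0) _.
  by rewrite /p !poly.derivE !hornerE/=; ring.
apply: is_derive_line d => h; rewrite [h *: (1 : R)]mulr1 addr0.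
rewrite /p !hornerE/= /sqd (bigD1 i)//= [in RHS](bigD1 i)//=.
rewrite [in RHS](eq_bigr (fun j => (x ord0 j - y ord0 j) ^+ 2)); last first.
  by move=> j ji; rewrite !mxE eqxx (negbTE ji)/= mulr0 add0r.
by rewrite !mxE !eqxx/= mulr1 /a; ring.
Qed.

(* The exponent starts at 3 so that the second derivatives have no singularity. *)
Lemma laplacian_cutoff (r : R) x y m :
  laplacian (cutoff r x m.+3) y =
  m.+3%:R * (m.+2%:R * pospart (r ^+ 2 - sqd x y) ^+ m.+1 * (4 * sqd x y)
             - (2 * n%:R) * pospart (r ^+ 2 - sqd x y) ^+ m.+2).
Proof.
set q := fun y => r ^+ 2 - sqd x y; rewrite -/(q y).
have Cq k : Ck k setT q by exact: Ck_quadric.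
have dq z i : 'D_(e i) q z = 2 * (x ord0 i - z ord0 i).
  by case: (is_derive_quadric r x z i).
have d1 i : 'D_(e i) (cutoff r x m.+3) =
    fun z => (m.+3%:R * 2) * (pospart (q z) ^+ m.+2 * (x ord0 i - z ord0 i)).
  apply/funext => z; case: (is_derive_pospart_comp m.+1 z i (Cq 1%N)) => _.
  by rewrite dq -/(cutoff r x m.+3) => ->; ring.
have d2 i : 'D_(e i) ('D_(e i) (cutoff r x m.+3)) y =
    m.+3%:R * (m.+2%:R * pospart (q y) ^+ m.+1 * (4 * (x ord0 i - y ord0 i) ^+ 2)
      - 2 * pospart (q y) ^+ m.+2).
  rewrite d1.
  have A1 := is_derive_pospart_comp m y i (Cq 1%N).
  have A2 : is_derive y (e i) (fun z : 'rV[R]_n => x ord0 i - z ord0 i) (- 1).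
    have H := is_derive_coord y i i; rewrite eqxx in H.
    have := is_deriveB (is_derive_cst (x ord0 i : R) y (e i)) H.
    by rewrite sub0r.
  have := is_deriveZ (m.+3%:R * 2) (is_deriveM A1 A2).
  case=> _ /= ->; rewrite dq /GRing.scale/=; ring.
rewrite /laplacian (eq_bigr _ (fun i _ => d2 i)).
move: (pospart (q y) ^+ m.+1) (pospart (q y) ^+ m.+2) => P1 P2.
rewrite -mulr_sumr sumrB -!mulr_sumr.
rewrite sumr_const card_ord -/(sqd x y) -mulr_natl; ring.
Qed.

End cutoff.

(** * Green's formula on a ball *)

Section green.
Context {R : realType} {n : nat}.
Local Notation e i := (delta_mx ord0 i : 'rV[R]_n).
Local Notation mu := (@lebesgue_rV R n).
Implicit Types (Omega : set 'rV[R]_n) (u v h : 'rV[R]_n -> R).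


Lemma compact_norm_bounded (K : set 'rV[R]_n) : compact K ->
  exists M : R, forall x, K x -> `|x| <= M.
Proof.
by move=> /compact_bounded[M [_ KM]]; exists (M + 1) => x Kx; apply: KM => //; rewrite ltrDl.
Qed.

Lemma Ck0_integrable Omega (B : set 'rV[R]_n) h : open B ->
  compactly_contained B Omega -> Ck 0 Omega h -> mu.-integrable B (EFin \o h).
Proof.
move=> oB [cB BO] Ch.
have sB : B `<=` closure B by exact: subset_closure.
have [C CB] := continuous_bounded_on cB (fun x Bx => Ck_continuous Ch (BO x Bx)).
have [M BM] := compact_norm_bounded cB.
have mB := open_measurable_lebesgueType oB.
apply: measurable_bounded_integrable => //.
- by apply: (lebesgue_rV_bounded_lty (M := M)) => // x /sB; exact: BM.
- apply: continuous_measurable_lebesgueType => // x /sB /BO; exact: (Ck_continuous Ch).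
- exists C; split; first exact: num_real.
  by move=> y Cy x Bx /=; rewrite (le_trans (CB _ (sB _ Bx)))// ltW.
Qed.

Lemma Ck_supp k Omega (K : set 'rV[R]_n) h : open Omega -> closed K -> K `<=` Omega ->
  Ck k Omega h -> (forall y, ~ K y -> h y = 0) -> Ck k setT h.
Proof.
move=> oO cK KO Ch h0; apply: Ck_local => y _.
have [Ky|nKy] := pselect (K y).
  by exists Omega; split => //; exact: KO.
exists (~` K); split => //; first exact: closed_openC.
apply: (Ck_eq _ _ (Ck_cst k (~` K) 0)); first exact: closed_openC.
by move=> z /h0 ->.
Qed.

Lemma compact_measurable_lebesgueType (K : set 'rV[R]_n) :
  compact K -> @measurable _ (lebesgueType R n) K.
Proof.
move=> cK; rewrite -[K]setCK; apply: measurableC; apply: open_measurable_lebesgueType.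
by apply: closed_openC; apply: compact_closed cK; exact: norm_hausdorff.
Qed.

Lemma Rintegral_D_supp Omega (K : set 'rV[R]_n) h i :
  open Omega -> compact K -> K `<=` Omega ->
  Ck 1 Omega h -> (forall y, ~ K y -> h y = 0) ->
  [/\ forall y, ~ K y -> 'D_(e i) h y = 0,
      mu.-integrable setT (EFin \o 'D_(e i) h) &
      \int[mu]_y ('D_(e i) h y) = 0].
Proof.
move=> oO cK KO Ch h0.
have clK : closed K by apply: compact_closed cK; exact: norm_hausdorff.
have Ch' := Ck_supp oO clK KO Ch h0.
have [M KM] := compact_norm_bounded cK.
have D0 y : ~ K y -> 'D_(e i) h y = 0.
  move=> nKy; rewrite -(@derive_cst _ _ R^o (0 : R) y (e i)).
  apply: near_eq_derive.
  have : nbhs y (~` K) by apply: open_nbhs_nbhs; split => //; exact: closed_openC.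
  by apply: filterS => z; exact: h0.
have MK y : M < `|y| -> ~ K y by move=> My /KM; rewrite leNgt My.
have cD : continuous ('D_(e i) h) by move=> y; exact: (Ck_continuous (Ck_D i Ch')).
have D0' y : M < `|y| -> 'D_(e i) h y = 0 by move=> /MK; exact: D0.
have [C DC] := continuous_bounded_supp cD D0'.
have intD : mu.-integrable setT (EFin \o 'D_(e i) h).
  have mK := compact_measurable_lebesgueType cK.
  have mD : @measurable_fun _ _ (lebesgueType R n) R setT ('D_(e i) h).
    by apply: continuous_measurable_lebesgueType; [exact: openT|move=> y _; exact: cD].
  exact: (@integrable_bounded_supp R _ (lebesgueType R n) mu ('D_(e i) h) K C mK
    (lebesgue_rV_bounded_lty mK KM) mD DC D0).
split => //.
rewrite /Rintegral integral_lebesgue_borel//; last first.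
  apply/measurable_EFinP; apply: continuous_measurable_rV; first exact: openT.
  by move=> y _; exact: cD.
have dh y : is_derive y (e i) h ('D_(e i) h y).
  by apply: derivableP; exact: (Ck_derivable Ch').
have h0' y : M < `|y| -> h y = 0 by move=> /MK; exact: h0.
by rewrite (integral_derive_supp dh cD h0' D0').
Qed.

Lemma pospart_quadric_ball (r : R) (x y : 'rV[R]_n) : 0 < r -> l2ball x r y ->
  pospart (r ^+ 2 - sqd x y) = r ^+ 2 - (l2dist x y) ^+ 2.
Proof.
move=> r0 xy; rewrite /pospart -sqr_l2dist max_l// subr_ge0.
by rewrite ler_pXn2r// ?nnegrE ?l2dist_ge0 1?ltW.
Qed.

Lemma pospart_quadric_out (r : R) (x y : 'rV[R]_n) : 0 < r -> ~ l2ball x r y ->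
  pospart (r ^+ 2 - sqd x y) = 0.
Proof.
move=> r0 /negP; rewrite -leNgt => xy.
by rewrite /pospart -sqr_l2dist max_r// subr_le0 ler_pXn2r// nnegrE ?l2dist_ge0 1?ltW.
Qed.

(** The divergence of the field [kap] grad [h] - [h] grad [kap] is the difference of the two
    integrands. The field vanishes off the closed ball, so each partial derivative in the divergence
    integrates to 0 over the whole space. *)
Lemma green_cutoff Omega x (r : R) h m : open Omega -> 0 < r ->
  compactly_contained (l2ball x r) Omega -> Ck 2 Omega h ->
  \int[mu]_(y in l2ball x r) (cutoff r x m.+3 y * laplacian h y) =
  \int[mu]_(y in l2ball x r) (laplacian (cutoff r x m.+3) y * h y).
Proof.
move=> oO r0 cc Ch; have [cB BO] := cc.
set B := l2ball x r; set K := closure B; set kap := cutoff r x m.+3.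
have oB : open B by exact: l2ball_open.
have mB := open_measurable_lebesgueType oB.
have Ckap k : (k <= m.+2)%N -> Ck k Omega kap.
  by move=> km; apply: Ck_subset (Ck_cutoff r x km).
have kap0 y : ~ B y -> kap y = 0.
  by move=> nBy; rewrite /kap /cutoff pospart_quadric_out// expr0n.
have Dkap0 i y : ~ B y -> 'D_(e i) kap y = 0.
  move=> nBy; case: (is_derive_pospart_comp m.+1 y i (Ck_quadric 1 r x)) => _ ->.
  by rewrite pospart_quadric_out// expr0n mulr0 mul0r.
have Lkap0 y : ~ B y -> laplacian kap y = 0.
  by move=> nBy; rewrite laplacian_cutoff pospart_quadric_out// !expr0n !(mulr0,mul0r) subrr mulr0.
pose F i y := kap y * 'D_(e i) h y - 'D_(e i) kap y * h y.
have CF i : Ck 1 Omega (F i).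
  exact: (Ck_sub oO (Ck_mul oO (Ckap 1%N isT) (Ck_D i Ch))
                    (Ck_mul oO (Ck_D i (Ckap 2%N isT)) (CkS_Ck Ch))).
have nKB y : ~ K y -> ~ B y by apply: contra_not; exact: subset_closure.
have F0 i y : ~ K y -> F i y = 0.
  by move=> /nKB nBy; rewrite /F kap0// Dkap0// !mul0r subrr.
have H i := Rintegral_D_supp i oO cB BO (CF i) (F0 i).
have sumF y : \sum_(i < n) 'D_(e i) (F i) y =
    ((fun y => kap y * laplacian h y - laplacian kap y * h y) \_ B) y.
  have [Ky|nKy] := pselect (K y); last first.
    rewrite big1 => [|i _]; last by have [D0 _ _] := H i; exact: D0.
    by rewrite patchE memNset//; exact: nKB.
  have Oy := BO _ Ky.
  transitivity (kap y * laplacian h y - laplacian kap y * h y).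
    rewrite /laplacian mulr_sumr mulr_suml -sumrB; apply: eq_bigr => i _.
    have dk := Ck_derivable (i := i) (Ckap 1%N isT) Oy.
    have ddk := Ck_derivable (i := i) (Ck_D i (Ckap 2%N isT)) Oy.
    have dh := Ck_derivable (i := i) Ch Oy.
    have ddh := Ck_derivable (i := i) (Ck_D i Ch) Oy.
    have [_ E] := is_deriveB (is_deriveM (derivableP dk) (derivableP ddh))
                             (is_deriveM (derivableP ddk) (derivableP dh)).
    apply: etrans E _; rewrite /GRing.scale/=.
    move: (kap y) (h y) ('D_(e i) h y) ('D_(e i) kap y) ('D_(e i) ('D_(e i) h) y)
      ('D_(e i) ('D_(e i) kap) y) => a b c d p q; ring.
  (* Points of the closure outside the open ball: [kap] and its Laplacian vanish there. *)
  rewrite patchE; case: ifPn => //; rewrite notin_setE => nBy.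
  by rewrite kap0// Lkap0// !mul0r subrr.
have int1 : mu.-integrable B (EFin \o (fun y => kap y * laplacian h y)).
  apply: (Ck0_integrable oB cc).
  exact: (Ck_mul oO (Ckap 0%N (leq0n _)) (Ck_laplacian oO Ch)).
have int2 : mu.-integrable B (EFin \o (fun y => laplacian kap y * h y)).
  apply: (Ck0_integrable oB cc).
  have Lk : Ck 0 Omega (laplacian kap) by apply: (Ck_laplacian oO); exact: Ckap.
  exact: (Ck_mul oO Lk (Ck_le (leq0n 2) Ch)).
apply/eqP; rewrite -subr_eq0 -RintegralB//; apply/eqP.
rewrite Rintegral_mkcond.
transitivity (\int[mu]_y (\sum_(i < n) 'D_(e i) (F i) y)).
  by apply: eq_Rintegral => y _; rewrite sumF.
rewrite /Rintegral; under eq_integral do rewrite -sumEFin.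
rewrite integral_sum//; last by move=> i; have [] := H i.
rewrite big1// => i _; have [_ intD I0] := H i.
rewrite -[LHS]fineK; first by congr EFin; exact: I0.
exact: integrable_fin_num.
Qed.
End green.

(** * From w to its Laplacian *)

Section core.
Context {R : realType} {n : nat}.
Local Notation e i := (delta_mx ord0 i : 'rV[R]_n).
Local Notation mu := (@lebesgue_rV R n).
Implicit Types (Omega : set 'rV[R]_n) (u v h : 'rV[R]_n -> R).

Local Notation null x r h := (null_on_sublevels (@lebesgue_rV R n) (l2dist x) r h).

Lemma measurable_l2dist (x : 'rV[R]_n) :
  @measurable_fun _ _ (lebesgueType R n) R setT (l2dist x).
Proof.
apply: continuous_measurable_lebesgueType; first exact: openT.
by move=> y _; exact: l2dist_continuous.
Qed.

Lemma cutoff_ball (r : R) (x y : 'rV[R]_n) m : 0 < r -> l2ball x r y ->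
  cutoff r x m y = (r ^+ 2 - l2dist x y ^+ 2) ^+ m.
Proof. by move=> r0 xy; rewrite /cutoff (pospart_quadric_ball r0 xy). Qed.

(** After Green's formula [h] is tested against the Laplacian of the cutoff, which on the ball is a
    polynomial in the distance to [x]; [null_on_sublevels_poly] covers exactly such weights. *)
Lemma cutoff_laplacian_null Omega x (r : R) h m : open Omega -> 0 < r ->
  compactly_contained (l2ball x r) Omega -> Ck 2 Omega h -> null x r h ->
  \int[mu]_(y in l2ball x r) (cutoff r x m.+3 y * laplacian h y) = 0.
Proof.
move=> oO r0 cc Ch nh; rewrite (green_cutoff m oO r0 cc Ch).
pose q : {poly R} := (r ^+ 2)%:P - 'X ^+ 2.
pose p : {poly R} := m.+3%:R%:P * (m.+2%:R%:P * q ^+ m.+1 * (4%:P * 'X ^+ 2)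
  - (2 * n%:R)%:P * q ^+ m.+2).
have [_ H] := null_on_sublevels_poly (measurable_l2dist x) (l2dist_ge0 x) p nh.
have /H <- : 0 < r <= r by rewrite r0 lexx.
apply: eq_Rintegral => y /set_mem By; congr (_ * _).
rewrite laplacian_cutoff (pospart_quadric_ball r0 By) -sqr_l2dist /p /q.
by rewrite !(hornerE, horner_exp).
Qed.

(** A zero integral would make [f] vanish almost everywhere on [B], so [B] would be null, but a
    nonempty open set has positive measure. *)
Lemma Rintegral_gt0 (B : set 'rV[R]_n) f x : open B -> B x ->
  mu.-integrable B (EFin \o f) -> (forall y, B y -> 0 < f y) ->
  0 < \int[mu]_(y in B) f y.
Proof.
move=> oB Bx intf f0.
have mB := open_measurable_lebesgueType oB.
rewrite lt_neqAle Rintegral_ge0 ?andbT; last by move=> y /f0 /ltW.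
apply/eqP => /esym I0.
have I0' : (\int[mu]_(y in B) `|(EFin \o f) y| = 0)%E.
  transitivity (\int[mu]_(y in B) (f y)%:E)%E.
    by apply: eq_integral => y /set_mem /f0 fy /=; rewrite ger0_norm// ltW.
  by rewrite -[LHS]fineK ?integrable_fin_num//; congr EFin.
have mf : @measurable_fun _ _ (lebesgueType R n) _ B (EFin \o f) by case/integrableP: intf.
have /(ae_eq_integral_abs mu mB mf) [N [mN N0 NB]] := I0'.
have : mu B = 0.
  apply/eqP; rewrite eq_le measure_ge0 andbT -N0.
  apply: le_measure; rewrite ?inE// => y By; apply: NB => /= /(_ By)/eqP.
  by rewrite eqe gt_eqF// f0.
by apply/eqP; rewrite gt_eqF//; exact: lebesgue_rV_open_gt0 oB Bx.
Qed.

Lemma open_sub_closed_ball Omega (x : 'rV[R]_n) : open Omega -> Omega x ->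
  exists2 d : R, 0 < d & forall y, `|x - y| <= d -> Omega y.
Proof.
move=> oO Ox; have /nbhs_ballP[d /= d0 dO] := open_nbhs_nbhs (conj oO Ox).
exists (d / 2); first by rewrite divr_gt0.
move=> y xy; apply: dO; rewrite -ball_normE /=.
by rewrite (le_lt_trans xy)// gtr_pMr// invf_lt1// ltr1n.
Qed.

Lemma cutoff_localize Omega x h : open Omega -> Omega x -> Ck 0 Omega h ->
  (forall r : R, 0 < r -> compactly_contained (l2ball x r) Omega ->
     \int[mu]_(y in l2ball x r) (cutoff r x 3 y * h y) = 0) ->
  h x = 0.
Proof.
move=> oO Ox Ch I0; apply/eqP/negPn/negP => hx0.
(* Multiplying by [h x] treats both signs at once: [g] is positive at [x], hence on a small ball,
   where the cutoff is positive too. *)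
pose g y := h x * h y.
have Cg : Ck 0 Omega g by exact: Ck_scale.
have gx0 : 0 < g x by rewrite /g -expr2 exprn_even_gt0.
pose V := Omega `&` g @^-1` [set t | 0 < t].
have oV : open V.
  by apply: open_setI_preimage => // y Oy; exact: (Ck_continuous Cg).
have Vx : V x by split.
have [r r0 rV] := open_sub_closed_ball oV Vx.
have cc : compactly_contained (l2ball x r) Omega.
  by apply: compactly_contained_l2ball => y /rV[].
have BV : l2ball x r `<=` V.
  by move=> y /= xy; apply: rV; rewrite (le_trans (norm_le_l2dist _ _))// ltW.
have Ck0 : Ck 0 Omega (cutoff r x 3) by apply: Ck_subset (Ck_cutoff r x _).
have int1 := Ck0_integrable (@l2ball_open R n x r) cc (Ck_mul oO Ck0 Ch).
have := I0 r r0 cc; apply/eqP; rewrite -(mulrI_eq0 _ (lregP hx0)).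
rewrite -RintegralZl//; last exact: open_measurable_lebesgueType (@l2ball_open R n x r).
rewrite gt_eqF// (Rintegral_gt0 (@l2ball_open R n x r) (l2ball_center x r0))//.
  have := Ck0_integrable (@l2ball_open R n x r) cc (Ck_scale (h x) oO (Ck_mul oO Ck0 Ch)).
  done.
move=> y By; rewrite mulrCA mulr_gt0//; last by case: (BV _ By).
by rewrite (cutoff_ball 3 r0 By) exprn_gt0// subr_gt0 ltr_pXn2r// nnegrE ?l2dist_ge0// ltW.
Qed.

End core.

(** * Passing from a weight to its Laplacian *)

Section step.
Context {R : realType} {n : nat}.
Local Notation e i := (delta_mx ord0 i : 'rV[R]_n).
Local Notation mu := (@lebesgue_rV R n).
Implicit Types (Omega : set 'rV[R]_n) (u v h : 'rV[R]_n -> R).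

Local Notation null x r h := (null_on_sublevels (@lebesgue_rV R n) (l2dist x) r h).

Lemma derive_congr_open Omega h h' i x : open Omega -> Omega x ->
  (forall y, Omega y -> h y = h' y) -> 'D_(e i) h x = 'D_(e i) h' x.
Proof.
move=> oO Ox hh'; apply: near_eq_derive.
by apply: filterS (open_nbhs_nbhs (conj oO Ox)) => y; exact: hh'.
Qed.

Lemma laplacian_subZ Omega h h' (c : R) x : open Omega -> Omega x ->
  Ck 2 Omega h -> Ck 2 Omega h' ->
  laplacian (fun y => h y - c * h' y) x = laplacian h x - c * laplacian h' x.
Proof.
have D1 (f f' : 'rV[R]_n -> R) i y : Ck 1 Omega f -> Ck 1 Omega f' -> Omega y ->
    'D_(e i) (fun z => f z - c * f' z) y = 'D_(e i) f y - c * 'D_(e i) f' y.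
  move=> Cf Cf' Oy.
  have df := derivableP (Ck_derivable (i := i) Cf Oy).
  have df' := derivableP (Ck_derivable (i := i) Cf' Oy).
  by have [_ E] := is_deriveB df (is_deriveZ c df').
move=> oO Ox Ch Ch'; rewrite /laplacian mulr_sumr -sumrB; apply: eq_bigr => i _.
rewrite (derive_congr_open i oO Ox (h' := fun z => 'D_(e i) h z - c * 'D_(e i) h' z)).
  by apply: D1 => //; exact: Ck_D.
by move=> y Oy; apply: D1 => //; exact: CkS_Ck.
Qed.

(* With [psi = 1 - (r^2 - |x - y|^2)^3 / r^6], the integrals of [psi^j g] do not depend
   on [j], and [psi^j] tends to 0 on the ball. *)
Lemma cutoff_moments Omega x (r : R) g : 0 < r ->
  compactly_contained (l2ball x r) Omega -> open Omega -> Ck 0 Omega g ->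
  (forall m, \int[mu]_(y in l2ball x r) (cutoff r x m.+3 y * g y) = 0) ->
  \int[mu]_(y in l2ball x r) g y = 0.
Proof.
move=> r0 cc oO Cg I0.
set B := l2ball x r.
have oB : open B by exact: l2ball_open.
have mB := open_measurable_lebesgueType oB.
have intB f : Ck 0 Omega f -> mu.-integrable B (EFin \o f) by exact: Ck0_integrable oB cc.
have r6 : 0 < r ^+ 6 by rewrite exprn_gt0.
have Ccut m : Ck 0 Omega (cutoff r x m.+1) by apply: Ck_subset (Ck_cutoff r x _).
(* [r ^+ 6] is the maximum of this cutoff, attained at the centre, so [psi] takes its values in
   [[0, 1)] on the open ball. *)
pose psi y := 1 - (r ^+ 6)^-1 * cutoff r x 3 y.
have Cpsi j : Ck 0 Omega (fun y => psi y ^+ j).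
  by apply: Ck_exp => //; apply: Ck_sub => //; [exact: Ck_cst|exact: Ck_scale].
have psiB y : B y -> 0 <= psi y < 1.
  move=> By; rewrite /psi (cutoff_ball 3 r0 By).
  have d0 : 0 < r ^+ 2 - l2dist x y ^+ 2.
    by rewrite subr_gt0 ltr_pXn2r// nnegrE ?l2dist_ge0// ltW.
  rewrite gtrBl mulr_gt0 ?invr_gt0 ?exprn_gt0// andbT subr_ge0 mulrC ler_pdivrMr// mul1r.
  have -> : r ^+ 6 = (r ^+ 2) ^+ 3 by rewrite -exprM.
  by rewrite ler_pXn2r// ?nnegrE ?(ltW d0) ?sqr_ge0// gerBl sqr_ge0.
(* Expanding one factor [psi] produces the same integral with the exponent of the cutoff raised by
   3, hence the quantification over [m] in the induction. *)
have J0 j m : \int[mu]_(y in B) (psi y ^+ j * (cutoff r x m.+3 y * g y)) = 0.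
  elim: j m => [|j IH] m.
    by under eq_Rintegral do rewrite expr0 mul1r; exact: I0.
  transitivity (\int[mu]_(y in B) ((psi y ^+ j * (cutoff r x m.+3 y * g y)) -
     (r ^+ 6)^-1 * (psi y ^+ j * (cutoff r x (m.+3).+3 y * g y)))).
    apply: eq_Rintegral => y _; rewrite exprSr; move: (psi y ^+ j) => P.
    rewrite /psi /cutoff !exprS; move: (pospart _) (_^-1) => t s; ring.
  have i1 k : mu.-integrable B (EFin \o (fun y => psi y ^+ j * (cutoff r x k.+1 y * g y))).
    apply: intB; exact: (Ck_mul oO (Cpsi j) (Ck_mul oO (Ccut k) Cg)).
  rewrite RintegralB//; last first.
    apply: (intB (fun y => _)); apply: Ck_scale => //.
    exact: (Ck_mul oO (Cpsi j) (Ck_mul oO (Ccut _) Cg)).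
  by rewrite RintegralZl// !IH mulr0 subrr.
have K0 j : \int[mu]_(y in B) (psi y ^+ j * g y) = \int[mu]_(y in B) g y.
  elim: j => [|j <-].
    by under eq_Rintegral do rewrite expr0 mul1r.
  transitivity (\int[mu]_(y in B) ((psi y ^+ j * g y) -
     (r ^+ 6)^-1 * (psi y ^+ j * (cutoff r x 3 y * g y)))).
    apply: eq_Rintegral => y _; rewrite exprSr; move: (psi y ^+ j) => P.
    rewrite /psi /cutoff !exprS; move: (pospart _) (_^-1) => t s; ring.
  have i1 : mu.-integrable B (EFin \o (fun y => psi y ^+ j * (cutoff r x 3 y * g y))).
    apply: intB; exact: (Ck_mul oO (Cpsi j) (Ck_mul oO (Ccut _) Cg)).
  rewrite RintegralB//.
  - by rewrite RintegralZl// J0 mulr0 subr0.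
  - by apply: intB; exact: (Ck_mul oO (Cpsi j) Cg).
  - apply: (intB (fun y => _)); apply: Ck_scale => //.
    exact: (Ck_mul oO (Cpsi j) (Ck_mul oO (Ccut _) Cg)).
have intg := intB _ Cg.
have intj j : mu.-integrable B (EFin \o (fun y => psi y ^+ j * g y)).
  by apply: intB; exact: (Ck_mul oO (Cpsi j) Cg).
have mj j : @measurable_fun _ _ (lebesgueType R n) _ B (EFin \o (fun y => psi y ^+ j * g y)).
  by have /integrableP[] := intj j.
have m0 : @measurable_fun _ _ (lebesgueType R n) _ B (cst (0%R : R)%:E) by exact: measurable_cst.
have cv : {ae mu, forall y, B y -> (psi y ^+ j * g y)%:E @[j --> \oo] --> (0%R)%:E}.
  apply: aeW => y By; apply: cvg_EFin; first exact: nearW.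
  have /andP[p0 p1] := psiB y By.
  rewrite -(mul0r (g y)); apply: cvgM; last exact: cvg_cst.
  by apply: cvg_expr; rewrite ger0_norm.
have igabs : mu.-integrable B (fun y => `|(g y)%:E|)%E by exact: (integrable_abse intg).
have dom : {ae mu, forall y (j : nat), B y ->
    (`|(EFin \o (fun y => (psi y ^+ j * g y)%R)) y| <= `|(g y)%:E|)%E}.
  apply: aeW => y j By /=; rewrite lee_fin normrM ler_piMl// normrX.
  have /andP[p0 p1] := psiB y By.
  by rewrite exprn_ile1// ger0_norm// ltW.
have [_ _ lim0] := dominated_convergence mB mj m0 cv igabs dom.
have E j : (\int[mu]_(y in B) (psi y ^+ j * g y)%R%:E = (\int[mu]_(y in B) g y)%R%:E)%E.
  rewrite -[LHS]fineK ?integrable_fin_num//; last exact: intj.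
  congr EFin; exact: K0.
have : (\int[mu]_(y in B) g y)%R%:E @[j --> \oo] --> 0%E.
  move: lim0; rewrite integral0_eq//; under eq_fun do rewrite E; exact.
by move=> /cvg_lim => /(_ (@ereal_hausdorff _)); rewrite lim_cst// => -[].
Qed.

Lemma laplacian_step Omega u v : open Omega -> Ck 2 Omega u -> Ck 2 Omega v ->
  Ck 2 Omega (laplacian v) ->
  (forall x (r : R), 0 < r -> compactly_contained (l2ball x r) Omega ->
    null x r (fun y => (u y - u x) * v y)) ->
  (forall x (r : R), 0 < r -> compactly_contained (l2ball x r) Omega ->
    null x r (fun y => (u y - u x) * laplacian v y)).
Proof.
move=> oO Cu Cv CLv N.
have Cuv : Ck 2 Omega (fun y => u y * v y) by exact: Ck_mul.
pose h x y := u y * v y - u x * v y.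
have Ch x : Ck 2 Omega (h x) := Ck_sub oO Cuv (Ck_scale (u x) oO Cv).
have Lh x y : Omega y ->
    laplacian (h x) y = laplacian (fun y => u y * v y) y - u x * laplacian v y.
  by move=> Oy; exact: (laplacian_subZ (u x) oO Oy Cuv Cv).
have I0 x r m : 0 < r -> compactly_contained (l2ball x r) Omega ->
    \int[mu]_(y in l2ball x r) (cutoff r x m.+3 y * laplacian (h x) y) = 0.
  move=> r0 cc; apply: (cutoff_laplacian_null m oO r0 cc (Ch x)).
  by apply: null_on_sublevels_eq (N x r r0 cc) => y; rewrite /h mulrBl.
(* [h x] changes with the centre, so localization yields the identity at [x] alone. As [x] is
   arbitrary, for a fixed centre it gives [laplacian (h x) y = (u y - u x) * laplacian v y]
   throughout the ball. *)
have Luv x : Omega x -> laplacian (fun y => u y * v y) x = u x * laplacian v x.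
  move=> Ox; apply/eqP; rewrite -subr_eq0 -Lh//; apply/eqP.
  apply: (cutoff_localize oO Ox (Ck_laplacian oO (Ch x))) => r r0 cc.
  exact: I0.
move=> x r r0 cc.
have Cg : Ck 0 Omega (fun y => (u y - u x) * laplacian v y).
  exact: (Ck_mul oO (Ck_sub oO (Ck_le (leq0n 2) Cu) (Ck_cst 0 Omega (u x)))
                    (Ck_le (leq0n 2) CLv)).
split; first exact: (Ck0_integrable (@l2ball_open R n x r) cc Cg).
move=> s /andP[s0 sr].
have ccs : compactly_contained (l2ball x s) Omega.
  by apply: compactly_contained_sub cc => y /lt_le_trans; apply.
apply: (cutoff_moments s0 ccs oO Cg) => m.
rewrite -[RHS](I0 x s m s0 ccs); apply: eq_Rintegral => y /set_mem By.
have Oy : Omega y by case: ccs => _; apply; exact: subset_closure.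
by rewrite Lh// Luv// mulrBl.
Qed.

End step.

(** * Regularity of strongly harmonic functions *)

Section regularity.
Context {R : realType} {n : nat}.
Local Notation mu := (@lebesgue_rV R n).
Implicit Types (Omega : set 'rV[R]_n) (u v w : 'rV[R]_n -> R).

Local Notation null x r h := (null_on_sublevels (@lebesgue_rV R n) (l2dist x) r h).

Lemma Ck0_integrable_compact Omega (K : set 'rV[R]_n) (h : 'rV[R]_n -> R) :
  open Omega -> compact K -> K `<=` Omega -> Ck 0 Omega h ->
  mu.-integrable K (EFin \o h).
Proof.
move=> oO cK KO Ch.
have [C CK] := continuous_bounded_on cK (fun x Kx => Ck_continuous Ch (KO x Kx)).
have [M KM] := compact_norm_bounded cK.
have mK := compact_measurable_lebesgueType cK.
apply: measurable_bounded_integrable => //.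
- exact: lebesgue_rV_bounded_lty mK KM.
- apply: (@measurable_funS _ _ (lebesgueType R n) _ Omega) => //.
    exact: open_measurable_lebesgueType.
  by apply: continuous_measurable_lebesgueType => // x Ox; exact: (Ck_continuous Ch).
- exists C; split; first exact: num_real.
  by move=> y Cy x Kx /=; rewrite (le_trans (CK _ Kx))// ltW.
Qed.

Lemma strongly_harmonic_integrable Omega w u (B : set 'rV[R]_n) :
  open Omega -> Ck 0 Omega w -> (forall x, Omega x -> 0 < w x) ->
  locally_integrable_wrt Omega w u -> open B -> compactly_contained B Omega ->
  mu.-integrable B (EFin \o (fun y => u y * w y)).
Proof.
move=> oO Cw w0 [mu_ iu] oB [cB BO].
have sB : B `<=` closure B by exact: subset_closure.
have mB := open_measurable_lebesgueType oB.
have mO := open_measurable_lebesgueType oO.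
apply: (@integrableS _ (lebesgueType R n) _ mu (closure B)) => //.
  exact: compact_measurable_lebesgueType.
apply/integrableP; split.
  have mw : @measurable_fun _ _ (lebesgueType R n) R Omega w.
    by apply: continuous_measurable_lebesgueType => // x Ox; exact: (Ck_continuous Cw).
  have muw := measurable_funM mu_ mw.
  by apply/measurable_EFinP; exact: (measurable_funS mO BO muw).
have := iu _ BO cB; congr (_ < _)%E; apply: eq_integral => y /set_mem /BO Oy /=.
by rewrite normrM (gtr0_norm (w0 y Oy)).
Qed.

Lemma strongly_harmonic_null Omega w u :
  open Omega -> Ck 0 Omega w -> (forall x, Omega x -> 0 < w x) ->
  strongly_harmonic Omega w u ->
  forall x (r : R), 0 < r -> compactly_contained (l2ball x r) Omega ->
    null x r (fun y => (u y - u x) * w y).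
Proof.
move=> oO Cw w0 [li mv] x r r0 cc.
have oB s : open (l2ball x s) by exact: l2ball_open.
have ccs s : s <= r -> compactly_contained (l2ball x s) Omega.
  by move=> sr; apply: compactly_contained_sub cc => y /lt_le_trans; apply.
have i1 s : s <= r -> mu.-integrable (l2ball x s) (EFin \o (fun y => u y * w y)).
  by move=> /ccs; apply: strongly_harmonic_integrable.
have i2 s : s <= r -> mu.-integrable (l2ball x s) (EFin \o w).
  by move=> /ccs c; exact: Ck0_integrable (oB s) c Cw.
have mB s := open_measurable_lebesgueType (oB s).
have i3 s : s <= r -> mu.-integrable (l2ball x s) (EFin \o (fun y => u x * w y)).
  move=> sr; rewrite (_ : _ \o _ = (fun y => (u x)%:E * (w y)%:E))%E//.
  by apply: integrableZl => //; exact: i2.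
have -> : (fun y => (u y - u x) * w y) = (fun y => u y * w y - u x * w y).
  by apply/funext => y; rewrite mulrBl.
split.
  rewrite (_ : _ \o _ = (EFin \o (fun y => (u y * w y)%R)) \-
    (EFin \o (fun y => (u x * w y)%R)))%E//.
  by apply: integrableB => //; [exact: mB|exact: i1|exact: i3].
move=> s /andP[s0 sr].
rewrite RintegralB; [|exact: mB|exact: i1|exact: i3].
rewrite RintegralZl; [|exact: mB|exact: i2].
have W0 : 0 < \int[mu]_(y in l2ball x s) w y.
  apply: (Rintegral_gt0 (oB s) (l2ball_center x s0)); first exact: i2.
  move=> y By; apply: w0; have [_] := ccs s sr; apply; exact: subset_closure.
rewrite {1}(mv x s s0 (ccs s sr)) mulrAC mulVf ?gt_eqF// mul1r.
exact: subrr.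
Qed.

(** Positivity of [v] enters twice: it identifies [|u| v] with [|u v|] for local integrability, and
    it makes the total weight of a ball invertible. *)
Lemma null_strongly_harmonic Omega v u :
  open Omega -> Ck 0 Omega v -> (forall x, Omega x -> 0 < v x) -> Ck 0 Omega u ->
  (forall x (r : R), 0 < r -> compactly_contained (l2ball x r) Omega ->
    null x r (fun y => (u y - u x) * v y)) ->
  strongly_harmonic Omega v u.
Proof.
move=> oO Cv v0 Cu N; split.
  split.
    by apply: continuous_measurable_lebesgueType => // x Ox; exact: (Ck_continuous Cu).
  move=> K KO cK.
  have := Ck0_integrable_compact oO cK KO (Ck_mul oO Cu Cv).
  move=> /integrableP[_]; congr (_ < _)%E; apply: eq_integral => y /set_mem /KO Oy /=.
  by rewrite normrM (gtr0_norm (v0 y Oy)).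
move=> x r r0 cc; have [_ H] := N x r r0 cc.
have oB : open (l2ball x r) by exact: l2ball_open.
have mB := open_measurable_lebesgueType oB.
have i1 := Ck0_integrable oB cc (Ck_mul oO Cu Cv).
have i2 := Ck0_integrable oB cc Cv.
have i3 := Ck0_integrable oB cc (Ck_scale (u x) oO Cv).
have V0 : 0 < \int[mu]_(y in l2ball x r) v y.
  apply: (Rintegral_gt0 oB (l2ball_center x r0) i2).
  by move=> y By; apply: v0; have [_] := cc; apply; exact: subset_closure.
have /H : 0 < r <= r by rewrite r0 lexx.
under eq_Rintegral do rewrite mulrBl.
rewrite (RintegralB mB i1 i3) (RintegralZl _ mB i2) => /eqP.
by rewrite subr_eq0 => /eqP ->; rewrite mulrCA mulVf ?mulr1// gt_eqF.
Qed.

Lemma cutoff_translate (r : R) (x y : 'rV[R]_n) m :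
  cutoff r 0 m (x - y) = cutoff r x m y.
Proof.
rewrite /cutoff; congr (pospart (_ - _) ^+ _); rewrite /sqd; apply: eq_bigr => i _.
by rewrite !mxE sub0r sqrrN.
Qed.

(** Near [x0], [u] is the quotient [A / W] of the convolutions of [u w] and [w] with one cutoff of
    fixed radius. Both inherit two derivatives from the kernel, whatever the regularity of [u w],
    and [W] is positive. *)
Lemma strongly_harmonic_C2 Omega w u :
  open Omega -> Ck 0 Omega w -> (forall x, Omega x -> 0 < w x) ->
  strongly_harmonic Omega w u -> Ck 2 Omega u.
Proof.
move=> oO Cw w0 sh; apply: Ck_local => x0 Ox0.
have [d d0 dO] := open_sub_closed_ball oO Ox0.
pose U : set 'rV[R]_n := ball x0 d; pose V : set 'rV[R]_n := ball x0 (d / 2).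
(* Balls of radius [d / 4] centred in [V] stay within [3 d / 4] of [x0], hence inside [U]. *)
pose r := d / 4.
have r0 : 0 < r by rewrite divr_gt0.
have oU : open U by exact: ball_open.
have oV : open V by apply: ball_open; rewrite divr_gt0.
have clU : closure U `<=` [set y | `|x0 - y| <= d].
  have : closed [set y : 'rV[R]_n | `|x0 - y| <= d].
    rewrite (_ : mkset _ = (fun y : 'rV[R]_n => `|x0 - y|) @^-1` [set t | t <= d])//.
    apply: closed_comp; last exact: closed_le.
    move=> y _; apply: (@continuous_comp _ _ _ (fun y : 'rV[R]_n => x0 - y)).
      exact: cvgB (@cvg_cst _ _ _ _ _) (@cvg_id _ _).
    exact: norm_continuous.
  move=> /closure_id ->; apply: closure_subset => y.
  by rewrite /U -ball_normE /= => /ltW.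
have ccU : compactly_contained U Omega.
  split; last by move=> y /clU; exact: dO.
  apply: bounded_closed_compact; last exact: closed_closure.
  exists (`|x0| + d); split; first exact: num_real.
  move=> M xM y /clU /= xy; rewrite (le_trans _ (ltW xM))//.
  rewrite -[y](subrK x0) addrC (le_trans (ler_normD _ _))//.
  by rewrite lerD2l distrC.
have UM (y : 'rV[R]_n) : U y -> `|y| <= `|x0| + d.
  move=> /subset_closure/clU /= xy.
  rewrite -[y](subrK x0) addrC (le_trans (ler_normD _ _))//.
  by rewrite lerD2l distrC.
have BU x : V x -> l2ball x r `<=` U.
  rewrite /V -ball_normE /= => Vx y xy; rewrite /U -ball_normE /=.
  rewrite (le_lt_trans (ler_distD x _ _))//.
  rewrite (lt_le_trans (ltrD Vx (le_lt_trans (norm_le_l2dist _ _) xy)))//.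
  by rewrite /r; lra.
have [li mv] := sh.
have mU := open_measurable_lebesgueType oU.
have intuw := strongly_harmonic_integrable oO Cw w0 li oU ccU.
have intw := Ck0_integrable oU ccU Cw.
have Ckap : Ck 2 setT (cutoff r (0 : 'rV[R]_n) 3) by exact: Ck_cutoff.
have ckap : continuous (cutoff r (0 : 'rV[R]_n) 3).
  by move=> y; exact: (Ck_continuous Ckap).
have CA := Ck_kernel_integral mU UM intuw Ckap.
have CW := Ck_kernel_integral mU UM intw Ckap.
set A := kernel_integral _ _ _ in CA; set W := kernel_integral _ _ _ in CW.
(* The translated cutoff vanishes off its ball, so the fixed domain [U] may be exchanged for the
   moving ball. *)
have kerE x f : V x -> kernel_integral U f (cutoff r 0 3) x =
    \int[mu]_(y in l2ball x r) (cutoff r x 3 y * f y).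
  move=> Vx; rewrite /kernel_integral [LHS]Rintegral_mkcond [RHS]Rintegral_mkcond.
  apply: eq_Rintegral => y _; rewrite !patchE cutoff_translate.
  have [By|nBy] := pselect (l2ball x r y).
    by rewrite !mem_set//; exact: BU By.
  rewrite (memNset nBy); case: ifPn => // _.
  by rewrite /cutoff pospart_quadric_out// expr0n mul0r.
have ccB x : V x -> compactly_contained (l2ball x r) Omega.
  by move=> Vx; apply: compactly_contained_sub ccU; exact: BU.
have W0 x : V x -> 0 < W x.
  move=> Vx; rewrite /W kerE//.
  apply: (Rintegral_gt0 (@l2ball_open R n x r) (l2ball_center x r0)).
    apply: (Ck0_integrable (@l2ball_open R n x r) (ccB x Vx)).
    by apply: (Ck_mul oO _ Cw); apply: Ck_subset (Ck_cutoff r x _).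
  move=> y By; rewrite mulr_gt0//.
    by rewrite (cutoff_ball 3 r0 By) exprn_gt0// subr_gt0 ltr_pXn2r// nnegrE ?l2dist_ge0// ltW.
  by apply: w0; have [_] := ccB x Vx; apply; exact: subset_closure.
(* The mean value property with a radial weight: on the ball the cutoff is the polynomial [p] of the
   distance, against which [(u - u x) w] integrates to 0. *)
have AW x : V x -> A x = u x * W x.
  move=> Vx.
  have := strongly_harmonic_null oO Cw w0 sh r0 (ccB x Vx).
  pose p : {poly R} := ((r ^+ 2)%:P - 'X ^+ 2) ^+ 3.
  move=> /(null_on_sublevels_poly (measurable_l2dist x) (l2dist_ge0 x) p)[_].
  move=> /(_ r); rewrite r0 lexx => /(_ isT) I0.
  apply/eqP; rewrite -subr_eq0 /A /W !kerE//; apply/eqP; rewrite -[RHS]I0.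
  have oB := @l2ball_open R n x r.
  have mB := open_measurable_lebesgueType oB.
  have BsU := BU x Vx.
  have i1 f : mu.-integrable U (EFin \o f) ->
      mu.-integrable (l2ball x r) (EFin \o (fun y => cutoff r x 3 y * f y)).
    move=> intf; apply: (integrableS mU mB BsU).
    have := kernel_integrable mU UM intf x ckap.
    by under [in X in X -> _]eq_fun do rewrite cutoff_translate.
  rewrite -RintegralZl; [|exact: mB|exact: i1].
  rewrite -RintegralB; [|exact: mB|exact: i1|].
    apply: eq_Rintegral => y /set_mem By.
    rewrite (cutoff_ball 3 r0 By) /p horner_exp hornerD hornerN horner_exp hornerX hornerC.
    move: (r ^+ 2 - _) (u y) (w y) (u x) => q a b c; ring.
  rewrite (_ : _ \o _ = (fun y => (u x)%:E * (cutoff r x 3 y * w y)%R%:E))%E//.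
  by apply: integrableZl => //; exact: i1.
exists V; split => //; first by apply: ballxx; rewrite divr_gt0.
have CA' := Ck_subset (@subsetT _ V) CA.
have CW' := Ck_subset (@subsetT _ V) CW.
have Wn0 x : V x -> W x != 0 by move=> /W0 Wx; rewrite gt_eqF.
apply: Ck_eq (Ck_mul oV CA' (Ck_inv oV Wn0 CW')) => // x Vx.
by rewrite AW// mulfK// Wn0.
Qed.

Lemma Ck_iter_laplacian Omega w : open Omega -> (forall k, Ck k Omega w) ->
  forall l k, Ck k Omega (iter l laplacian w).
Proof.
move=> oO Cw; elim=> [|l IH] k; first exact: Cw.
exact: (Ck_laplacian oO (IH k.+2)).
Qed.

Lemma strongly_harmonic_laplacian Omega w u :
  open Omega -> (forall k, Ck k Omega w) -> (forall x, Omega x -> 0 < w x) ->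
  strongly_harmonic Omega w u ->
  forall l, (forall x, Omega x -> 0 < iter l laplacian w x) ->
    strongly_harmonic Omega (iter l laplacian w) u.
Proof.
move=> oO Cw w0 sh l wl0.
have CL := Ck_iter_laplacian oO Cw.
have Cu := strongly_harmonic_C2 oO (Cw 0%N) w0 sh.
apply: (null_strongly_harmonic oO (CL l 0%N) wl0 (Ck_le (leq0n 2) Cu)).
(* [wl0] concerns the last Laplacian only; intermediate ones may change sign, so the induction runs
   on the vanishing integrals rather than on strong harmonicity. *)
elim: l {wl0} => [|l IH].
  exact: strongly_harmonic_null oO (Cw 0%N) w0 sh.
exact: (laplacian_step oO Cu (CL l 2%N) (CL l.+1 2%N) IH).
Qed.

End regularity.

(** * Smoothness of real analytic functions *)

Section limit_of_smooth.
Context {R : realType} {n : nat}.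
Local Notation e i := (delta_mx ord0 i : 'rV[R]_n).
(** To be read with [P N g] as the [N]-th partial sum of the derivative of order [g], [sh i g] as
    one more derivative in direction [i], and [T] as the partial sums of a convergent majorant. The
    Taylor bound is uniform in [N]; in the limit, divided by [t], it identifies the derivative of
    [G g] as [G (sh i g)]. Closure of the family under [sh] then gives all orders by induction. *)
Variables (Gam : Type) (sh : 'I_n -> Gam -> Gam) (V : set 'rV[R]_n).
Variables (P : nat -> Gam -> 'rV[R]_n -> R) (T : nat -> R) (C : Gam -> R)
  (C' : 'I_n -> Gam -> R).
Hypothesis oV : open V.
Hypothesis ndT : nondecreasing_seq T.
Hypothesis cvgT : cvgn T.
Hypothesis C0 : forall g, 0 <= C g.
Hypothesis P_cauchy : forall g N M x, (N <= M)%N -> V x ->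
  `|P M g x - P N g x| <= C g * (T M - T N).
Hypothesis P_taylor : forall g i N x t, V x -> V (t *: e i + x) ->
  `|P N g (t *: e i + x) - P N g x - t * P N (sh i g) x| <= C' i g * t ^+ 2.
Hypothesis P_continuous : forall N g, continuous (P N g).

Let G g x := limn (fun N => P N g x).

(* [C g * T N - s * P N g x] is nondecreasing and bounded for [s = 1]. *)
Lemma limit_cvg g x : V x -> P N g x @[N --> \oo] --> G g x.
Proof.
move=> Vx; have nd (s : R) : `|s| = 1 -> cvgn (fun N => C g * T N - s * P N g x).
  move=> s1; apply: nondecreasing_is_cvgn.
    move=> N M NM; have := P_cauchy g NM Vx.
    rewrite -(mul1r `|_ - _|) -s1 -normrM => /(le_trans (ler_norm _)).
    rewrite !mulrBr => H; rewrite lerBlDr -addrA.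
    by rewrite addrC addrAC -subr_ge0; lra.
  exists (C g * (limn T) + C g * `|limn T - T 0%N| + `|P 0%N g x|) => _ [N _ <-].
  have TN : T N <= limn T by apply: nondecreasing_cvgn_le.
  have TN0 : T 0%N <= T N by apply: ndT.
  have := P_cauchy g (leq0n N) Vx.
  have H1 : C g * (T N - T 0%N) <= C g * `|limn T - T 0%N|.
    by rewrite ler_wpM2l// (le_trans _ (ler_norm _))// lerD2r.
  move=> /le_trans/(_ H1) H2.
  rewrite -addrA lerD//; first by rewrite ler_wpM2l.
  rewrite (le_trans (ler_norm _))// normrN normrM s1 mul1r.
  by rewrite -[P N g x](subrK (P 0%N g x)) (le_trans (ler_normD _ _))// lerD2r.
have c1 := nd 1 (normr1 _).
have cT : cvgn (fun N => C g * T N).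
  by apply: cvgP; exact: cvgM (@cvg_cst _ (C g) _ _ _) cvgT.
suff E : (fun N => P N g x) = (fun N => C g * T N) - (fun N => C g * T N - 1 * P N g x).
  suff : cvgn (fun N => P N g x) by [].
  by rewrite E; exact: is_cvgB cT c1.
apply/funext => N.
have -> : ((fun N => C g * T N) - (fun N => C g * T N - 1 * P N g x)) N =
  C g * T N - (C g * T N - 1 * P N g x) by [].
by rewrite mul1r opprB addrC subrK.
Qed.

Lemma limit_dist g N x : V x -> `|G g x - P N g x| <= C g * (limn T - T N).
Proof.
move=> Vx.
have c1 : `|P M g x - P N g x| @[M --> \oo] --> `|G g x - P N g x|.
  exact: cvg_norm (cvgB (limit_cvg Vx) (cvg_cst _)).
have c2 : C g * (T M - T N) @[M --> \oo] --> C g * (limn T - T N).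
  exact: cvgM (cvg_cst _) (cvgB cvgT (cvg_cst _)).
apply: ler_cvg_to c1 c2 _.
by exists N => // M /= NM; exact: P_cauchy.
Qed.

Lemma limit_continuous g x : V x -> {for x, continuous (G g)}.
Proof.
move=> Vx; apply/(@cvgrPdist_lt _ _ _ (nbhs x) (nbhs_filter x)) => eps eps0.
have e3 : 0 < eps / 3 by rewrite divr_gt0.
have [N HN] : exists N, C g * (limn T - T N) < eps / 3.
  have : C g * (limn T - T N) @[N --> \oo] --> 0.
    rewrite -(mulr0 (C g)) -(subrr (limn T)).
    exact: cvgM (cvg_cst _) (cvgB (cvg_cst _) cvgT).
  move=> /cvgr0_norm_lt/(_ _ e3)[N _ /(_ N (leqnn N)) /= HN].
  by exists N; exact: le_lt_trans (ler_norm _) HN.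
near=> y.
have Vy : V y by near: y; exact: (open_nbhs_nbhs (conj oV Vx)).
have xy : `|P N g x - P N g y| < eps / 3.
  near: y; by have /(@cvgrPdist_lt _ _ _ (nbhs x) (nbhs_filter x)) := @P_continuous N g x; apply.
have h1 := le_lt_trans (limit_dist g N Vx) HN.
have h2 := le_lt_trans (limit_dist g N Vy) HN.
have -> : G g x - G g y = (G g x - P N g x) + (P N g x - P N g y) - (G g y - P N g y).
  by ring.
rewrite (le_lt_trans (ler_normB _ _))//.
rewrite (le_lt_trans (lerD (ler_normD _ _) (lexx _)))//.
by lra.
Unshelve. all: by end_near. Qed.

Lemma limit_taylor g i x t : V x -> V (t *: e i + x) ->
  `|G g (t *: e i + x) - G g x - t * G (sh i g) x| <= C' i g * t ^+ 2.
Proof.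
move=> Vx Vtx.
have c1 : `|P N g (t *: e i + x) - P N g x - t * P N (sh i g) x| @[N --> \oo] -->
    `|G g (t *: e i + x) - G g x - t * G (sh i g) x|.
  apply: cvg_norm; apply: cvgB; last exact: cvgM (cvg_cst _) (limit_cvg Vx).
  exact: cvgB (limit_cvg Vtx) (limit_cvg Vx).
apply: ler_cvg_to c1 (cvg_cst _) _.
by apply: nearW => N; exact: P_taylor.
Qed.

Lemma limit_is_derive g i x : V x -> is_derive x (e i) (G g) (G (sh i g) x).
Proof.
move=> Vx.
have E : h^-1 *: ((G g \o shift x) (h *: e i) - G g x) @[h --> (0 : R)^'] --> G (sh i g) x.
  apply/cvgrPdist_lt => eps eps0.
  have Vh : \forall h \near (0 : R), V (h *: e i + x).
    have : (h *: e i + x) @[h --> (0 : R)] --> (0 : R) *: e i + x.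
      by apply: cvgD; [apply: cvgZr_tmp; exact: cvg_id|exact: cvg_cst].
    rewrite scale0r add0r; apply; exact: (open_nbhs_nbhs (conj oV Vx)).
  have C'0 : 0 < `|C' i g| + 1 by rewrite ltr_wpDl.
  near=> h.
  have h0 : h != 0 by near: h; exact: nbhs_dnbhs_neq.
  have Vhx : V (h *: e i + x) by near: h; exact: nbhs_dnbhs.
  have hn : `|h| < eps / (`|C' i g| + 1).
    near: h; apply: dnbhs0_lt; rewrite divr_gt0//.
  have := limit_taylor g Vx Vhx => H.
  rewrite -(ltr_pM2l (x := `|h|)) ?normr_gt0// -normrM mulrBr.
  rewrite [h * (_ *: _)]mulrA mulfV// mul1r distrC /=.
  rewrite (le_lt_trans H)//.
  have n0 : 0 < `|h| by rewrite normr_gt0.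
  rewrite -(real_normK (num_real h)) expr2 mulrCA ltr_pM2l//.
  rewrite (le_lt_trans (ler_wpM2r (ltW n0) (ler_norm _)))//.
  move: hn; rewrite ltr_pdivlMr// mulrDr mulr1 mulrC => hn.
  by rewrite (le_lt_trans _ hn)// lerDl ltW.
split; first by apply/cvg_ex; exists (G (sh i g) x).
exact: cvg_lim E.
Unshelve. all: by end_near. Qed.

Lemma Ck_limit k g : Ck k V (G g).
Proof.
elim: k g => [|k IH] g.
  by split => // x; exact: limit_continuous.
split=> [x|i]; first exact: limit_continuous.
split=> [x Vx|]; first by case: (limit_is_derive g i Vx).
apply: Ck_eq (IH (sh i g)) => // x Vx.
by case: (limit_is_derive g i Vx).
Qed.

End limit_of_smooth.

(** * Derivatives of one-variable monomials and their bounds *)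

Section power_series.
Context {R : realType}.

Lemma bin_le_exp2 m g : ('C(m, g) <= 2 ^ m)%N.
Proof.
elim: m g => [|m IH] [|g]; rewrite ?bin0 ?expn_gt0//.
by rewrite binS expnS mul2n -addnn leq_add.
Qed.

(** A crude bound suffices: the factor [2 ^ m] is absorbed by halving the radius of convergence. *)
Lemma ffact_le m g : (m ^_ g <= g`! * 2 ^ m)%N.
Proof. by rewrite -bin_ffact mulnC leq_mul2l bin_le_exp2 orbT. Qed.

(* The [g]-th derivative of [z ^+ m]; for [m < g] the falling factorial vanishes, so
   the truncated exponent is harmless. *)
Definition fmono (m g : nat) (z : R) : R := (m ^_ g)%:R * z ^+ (m - g).

Lemma is_derive_fmono m g (z : R) : is_derive z (1 : R) (fmono m g) (fmono m g.+1 z).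
Proof.
have d : is_derive z (1 : R) (fun z : R => z ^+ (m - g)) ((m - g)%:R * z ^+ (m - g).-1).
  split; first exact: exprn_derivable.
  by rewrite exp_derive [LHS]mulr1.
have [H1 H2] := is_deriveZ (m ^_ g)%:R d.
split; first exact: H1.
by apply: etrans H2 _; rewrite /GRing.scale/= /fmono ffactnSr natrM subnS mulrA.
Qed.

(** The mean value theorem for endpoints in either order; the bound on [|s|] keeps the intermediate
    point in the interval where [fmono] is controlled. *)
Lemma mvt_between (f f' : R -> R) (z z' : R) :
  (forall s : R, is_derive s (1 : R) f (f' s)) ->
  exists s, [/\ `|s - z| <= `|z' - z|, `|s| <= Num.max `|z| `|z'| &
                f z' - f z = f' s * (z' - z)].
Proof.
move=> df.
have cf : continuous f.
  by move=> t; apply: differentiable_continuous; apply/derivable1_diffP; case: (df t).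
have aux (u v : R) : u <= v -> exists s, [/\ u <= s, s <= v & f v - f u = f' s * (v - u)].
  move=> uv; have [//|s] := @MVT_segment R f f' u v uv (fun s _ => df s).
    exact: continuous_subspaceT.
  by rewrite in_itv/= => /andP[us sv E]; exists s.
have [zz'|z'z] := leP z z'.
  have [s [zs sz' E]] := aux z z' zz'; exists s; split => //.
    by rewrite !ger0_norm ?subr_ge0// lerD2r.
  rewrite le_max; have [s0|s0] := leP 0 s.
    by rewrite (ger0_norm s0) (le_trans sz' (ler_norm _)) orbT.
  by rewrite ltr0_norm// ltr0_norm ?lerN2 ?zs// (le_lt_trans zs).
have [s [z's sz E]] := aux z' z (ltW z'z); exists s; split.
- by rewrite distrC [leRHS]distrC !ger0_norm ?subr_ge0// ?(ltW z'z)// lerD2l lerN2.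
- rewrite le_max; have [s0|s0] := leP 0 s.
    by rewrite (ger0_norm s0) (le_trans sz (ler_norm _)).
  by rewrite [`|s|]ltr0_norm// [`|z'|]ltr0_norm ?lerN2 ?z's ?orbT// (le_lt_trans z's).
- by rewrite -opprB E -mulrN opprB.
Qed.

Variable rho : R.
Hypothesis rho0 : 0 < rho.

(** What remains of [g! 2^m (rho/2)^(m-g)] once [rho^m] is split off; it no longer depends on
    [m]. *)
Definition fbound (g : nat) : R := g`!%:R * (2 / rho) ^+ g.

Lemma fbound_ge0 g : 0 <= fbound g.
Proof. by rewrite mulr_ge0// exprn_ge0// divr_ge0// ltW. Qed.

Lemma fmono_le m g z : `|z| <= rho / 2 -> `|fmono m g z| <= fbound g * rho ^+ m.
Proof.
move=> zr; rewrite /fmono; have [gm|mg] := leqP g m; last first.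
  rewrite ffact_small// mul0r normr0; apply: mulr_ge0; first exact: fbound_ge0.
  by apply: exprn_ge0; exact: ltW.
rewrite /fbound normrM ger0_norm// normrX.
apply: (@le_trans _ _ ((g`! * 2 ^ m)%:R * (rho / 2) ^+ (m - g))).
  apply: ler_pM => //; first by rewrite ler_nat ffact_le.
  by rewrite lerXn2r// nnegrE divr_ge0// ltW.
rewrite natrM natrX -{1 3}(subnKC gm) !exprD !exprMn !exprVn.
rewrite le_eqVlt; apply/orP; left; apply/eqP.
have r0 : rho ^+ g != 0 by rewrite expf_neq0// gt_eqF.
have t0 : (2 : R) ^+ (m - g) != 0 by rewrite expf_neq0.
by field; rewrite r0 t0.
Qed.

(** The mean value theorem twice, the second time between [z] and the first intermediate point,
    which is no farther from [z] than [z']. *)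
Lemma fmono_taylor m g z z' : `|z| <= rho / 2 -> `|z'| <= rho / 2 ->
  `|fmono m g z' - fmono m g z - (z' - z) * fmono m g.+1 z| <=
  fbound g.+2 * rho ^+ m * (z' - z) ^+ 2.
Proof.
move=> zr z'r.
have [s [s1 s2 ->]] := mvt_between z z' (is_derive_fmono m g).
have sr : `|s| <= rho / 2 by rewrite (le_trans s2)// ge_max zr.
rewrite [_ * (z' - z)]mulrC -mulrBr normrM.
have [s' [_ s'2 ->]] := mvt_between z s (is_derive_fmono m g.+1).
have s'r : `|s'| <= rho / 2 by rewrite (le_trans s'2)// ge_max zr.
rewrite normrM mulrCA -(real_normK (num_real (z' - z))) expr2.
rewrite ler_pM ?mulr_ge0//; first exact: fmono_le.
by rewrite ler_pM.
Qed.

End power_series.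

(** * Partial sums over cubes of a power series in several variables *)

Section cubes.
Context {R : realType} {n : nat}.
Implicit Types (al g : {ffun 'I_n -> nat}).
Local Notation e i := (delta_mx ord0 i : 'rV[R]_n).

Definition cube_val N (be : {ffun 'I_n -> 'I_N}) : {ffun 'I_n -> nat} :=
  [ffun i => be i : nat].

(** The index type of the sums in [real_analytic] changes with [N]; as lists in a single type, cubes
    of different sizes can be compared. *)
Definition cube N : seq {ffun 'I_n -> nat} := map (@cube_val N) (index_enum _).

Lemma cube_uniq N : uniq (cube N).
Proof.
rewrite map_inj_uniq ?index_enum_uniq// => be be' E.
by apply/ffunP => i; apply: val_inj; have /ffunP/(_ i) := E; rewrite !ffunE.
Qed.

Lemma mem_cube N al : (al \in cube N) = [forall i, (al i < N)%N].
Proof.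
apply/mapP/forallP => [[be _ ->] i|alN]; first by rewrite ffunE.
exists [ffun i => Ordinal (alN i)]; first by rewrite mem_index_enum.
by apply/ffunP => i; rewrite !ffunE.
Qed.

Lemma sum_cubeB N M (F : {ffun 'I_n -> nat} -> R) : (N <= M)%N ->
  \sum_(al <- cube M) F al - \sum_(al <- cube N) F al =
  \sum_(al <- cube M | al \notin cube N) F al.
Proof.
move=> NM; rewrite (bigID (mem (cube N)))/= addrAC.
suff -> : \sum_(al <- cube M | al \in cube N) F al = \sum_(al <- cube N) F al.
  by rewrite subrr add0r.
rewrite -big_filter; apply: perm_big; apply: uniq_perm.
- by rewrite filter_uniq// cube_uniq.
- exact: cube_uniq.
move=> al; rewrite mem_filter; have [|//] := boolP (al \in cube N).
rewrite mem_cube => /forallP alN /=; rewrite mem_cube; apply/forallP => i.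
exact: leq_trans (alN i) NM.
Qed.

Variables (a : 'rV[R]_n) (c : {ffun 'I_n -> nat} -> R) (rho S : R).
Hypothesis rho0 : 0 < rho.
Hypothesis cS : forall s : seq {ffun 'I_n -> nat}, uniq s ->
  \sum_(al <- s) `|c al| * \prod_i rho ^+ al i <= S.

Let V : set 'rV[R]_n := ball a (rho / 2).
Let K := fbound rho.

(** The mixed partial derivative of order [g] of the monomial [(x - a)^al]. *)
Definition pterm g al (x : 'rV[R]_n) : R :=
  \prod_i fmono (al i) (g i) (x ord0 i - a ord0 i).
Definition psum N g x : R := \sum_(al <- cube N) c al * pterm g al x.
Let T N : R := \sum_(al <- cube N) `|c al| * \prod_i rho ^+ al i.
Definition shift_index (i : 'I_n) g : {ffun 'I_n -> nat} :=
  [ffun j => if j == i then (g j).+1 else g j].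
Let C g : R := \prod_i K (g i).
Let C' i g : R := (\prod_(j | j != i) K (g j)) * K (g i).+2 * S.

Lemma in_ball_coord x i : V x -> `|x ord0 i - a ord0 i| <= rho / 2.
Proof.
rewrite /V -ball_normE/= => ax; rewrite distrC.
have := ler_coord_norm (a - x) i; rewrite mxE [X in _ + X]mxE => /le_trans; apply.
exact: ltW.
Qed.

Lemma rho_prod_ge0 al : 0 <= \prod_i rho ^+ al i.
Proof. by apply: prodr_ge0 => i _; rewrite exprn_ge0// ltW. Qed.

Lemma pterm_le g al x : V x -> `|pterm g al x| <= C g * \prod_i rho ^+ al i.
Proof.
move=> Vx; rewrite /pterm /C -big_split/= normr_prod.
apply: ler_prod => i _; rewrite normr_ge0/=.
by apply: fmono_le => //; exact: in_ball_coord.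
Qed.

Lemma C_ge0 g : 0 <= C g.
Proof. by apply: prodr_ge0 => i _; exact: fbound_ge0. Qed.

Lemma psum_cauchy g N M x : (N <= M)%N -> V x ->
  `|psum M g x - psum N g x| <= C g * (T M - T N).
Proof.
move=> NM Vx; rewrite /psum /T !sum_cubeB// mulr_sumr.
rewrite (le_trans (ler_norm_sum _ _ _))//; apply: ler_sum => al _.
rewrite normrM mulrCA ler_wpM2l//; exact: pterm_le.
Qed.

(** Moving along [e i] changes the [i]-th factor only: it obeys the one-variable Taylor bound, which
    accounts for [K (g i).+2], and the other factors are merely bounded. *)
Lemma pterm_taylor g i al x t : V x -> V (t *: e i + x) ->
  `|pterm g al (t *: e i + x) - pterm g al x - t * pterm (shift_index i g) al x| <=
  (\prod_(j | j != i) K (g j)) * K (g i).+2 * t ^+ 2 * \prod_i rho ^+ al i.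
Proof.
move=> Vx Vtx; rewrite /pterm (bigD1 i)//= [X in _ - X - _](bigD1 i)//=.
rewrite [X in _ - _ * X](bigD1 i)//=.
rewrite [X in _ <= X](_ : _ = (\prod_(j | j != i) K (g j)) * K (g i).+2 *
  t ^+ 2 * (rho ^+ al i * \prod_(j | j != i) rho ^+ al j)); last first.
  by congr (_ * _); rewrite (bigD1 i).
set x' := t *: e i + x.
have xi : x' ord0 i - a ord0 i - (x ord0 i - a ord0 i) = t.
  by rewrite /x' !mxE !eqxx/= mulr1; ring.
have -> : \prod_(j | j != i) fmono (al j) (g j) (x' ord0 j - a ord0 j) =
    \prod_(j | j != i) fmono (al j) (g j) (x ord0 j - a ord0 j).
  by apply: eq_bigr => j ji; rewrite !mxE eqxx (negbTE ji)/= mulr0 add0r.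
have -> : \prod_(j | j != i) fmono (al j) (shift_index i g j) (x ord0 j - a ord0 j) =
    \prod_(j | j != i) fmono (al j) (g j) (x ord0 j - a ord0 j).
  by apply: eq_bigr => j ji; rewrite ffunE (negbTE ji).
rewrite ffunE eqxx; set A := \prod_(j | j != i) fmono (al j) (g j) _.
rewrite [X in `|X|](_ : _ = (fmono (al i) (g i) (x' ord0 i - a ord0 i) -
  fmono (al i) (g i) (x ord0 i - a ord0 i) -
  t * fmono (al i) (g i).+1 (x ord0 i - a ord0 i)) * A); last by ring.
rewrite normrM.
have := fmono_taylor rho0 (al i) (g i) (in_ball_coord i Vx) (in_ball_coord i Vtx).
rewrite -/x' xi => H1.
have H2 : `|A| <=
    \prod_(j | j != i) K (g j) * \prod_(j | j != i) rho ^+ al j.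
  rewrite -big_split/= normr_prod; apply: ler_prod => j _; rewrite normr_ge0/=.
  by apply: fmono_le => //; exact: in_ball_coord.
rewrite (le_trans (ler_pM _ _ H1 H2))// le_eqVlt; apply/orP; left; apply/eqP.
rewrite /K; ring.
Qed.

Lemma psum_taylor g i N x t : V x -> V (t *: e i + x) ->
  `|psum N g (t *: e i + x) - psum N g x - t * psum N (shift_index i g) x| <=
  C' i g * t ^+ 2.
Proof.
move=> Vx Vtx; rewrite /psum mulr_sumr -!sumrB.
rewrite (le_trans (ler_norm_sum _ _ _))//.
set D := (\prod_(j | j != i) K (g j)) * K (g i).+2.
apply: (@le_trans _ _ (\sum_(al <- cube N) (D * t ^+ 2) * (`|c al| * \prod_i rho ^+ al i))).
  apply: ler_sum => al _.
  rewrite mulrCA -!mulrBr normrM mulrCA ler_wpM2l//; exact: pterm_taylor.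
rewrite -mulr_sumr /C' -/D [leRHS]mulrAC ler_wpM2l ?cS ?cube_uniq//.
rewrite mulr_ge0 ?sqr_ge0// /D mulr_ge0 ?fbound_ge0//.
by apply: prodr_ge0 => j _; exact: fbound_ge0.
Qed.

Lemma psum_continuous N g : continuous (psum N g).
Proof.
move=> x; apply: (@Ck_continuous R n 0 setT) => //.
apply: Ck_sum => [|al]; first exact: openT.
apply: Ck_scale; first exact: openT.
rewrite /pterm; elim: (index_enum _) => [|i s IH].
  by under eq_fun do rewrite big_nil; exact: Ck_cst.
under eq_fun do rewrite big_cons.
apply: Ck_mul => //; first exact: openT.
apply: Ck_scale; first exact: openT.
apply: Ck_exp; first exact: openT.
by apply: Ck_sub; [exact: openT|exact: Ck_coord|exact: Ck_cst].
Qed.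

Lemma Ck_power_series k g : Ck k V (fun x => limn (fun N => psum N g x)).
Proof.
have ndT : nondecreasing_seq T.
  move=> N M NM; rewrite -subr_ge0 /T sum_cubeB//.
  by apply: sumr_ge0 => al _; rewrite mulr_ge0// rho_prod_ge0.
have cT : cvgn T.
  apply: nondecreasing_is_cvgn => //; exists S => _ [N _ <-].
  by apply: cS; exact: cube_uniq.
have oV : open V by apply: ball_open; rewrite divr_gt0.
exact: (Ck_limit oV ndT cT C_ge0 psum_cauchy psum_taylor psum_continuous).
Qed.

End cubes.

Lemma summable_sum_le (R : realType) (I : choiceType) (f : I -> R) :
  summable [set: I] (fun i => (f i)%:E) ->
  exists S : R, forall s : seq I, uniq s -> \sum_(i <- s) `|f i| <= S.
Proof.
move=> sf; exists (fine (\esum_(i in [set: I]) `|(f i)%:E|)%E) => s us.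
rewrite -lee_fin fineK; last by move: sf; rewrite summableE.
apply: esum_ge; exists [set` s].
  by split => //; exact: finite_seq.
by rewrite -fsbig_seq// -sumEFin.
Qed.

(** Abel's argument: absolute convergence at the single diagonal point [a + (rho, ..., rho)] bounds
    the sums of [|c al| rho^|al|], a majorant for the series and all its derivatives on the ball of
    radius [rho / 2]. *)
Lemma real_analytic_Ck (R : realType) n (Omega : set 'rV[R]_n) w k :
  real_analytic Omega w -> Ck k Omega w.
Proof.
move=> aw; apply: Ck_local => a Oa.
have [c /nbhs_ballP[d /= d0 dP]] := aw a Oa.
(* In the sup norm the diagonal point is at distance at most [rho] from [a], strictly inside the
   ball of radius [d]. *)
pose rho := d / 2.
have rho0 : 0 < rho by rewrite divr_gt0.
pose xs : 'rV[R]_n := a + const_mx rho.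
have bxs : ball a d xs.
  rewrite -ball_normE/= opprD addNKr normrN.
  rewrite (le_lt_trans (rV_norm_le (ltW rho0) _))//.
    by move=> i; rewrite mxE ger0_norm// ltW.
  by rewrite /rho gtr_pMr// invf_lt1// ltr1n.
have [/summable_sum_le[S HS] _] := dP _ bxs.
have cS (s : seq {ffun 'I_n -> nat}) : uniq s ->
    \sum_(al <- s) `|c al| * \prod_i rho ^+ al i <= S.
  move=> us; rewrite (le_trans _ (HS s us))//; apply: ler_sum => al _.
  rewrite normrM ler_wpM2l// /monomial /xs addrC addKr.
  rewrite ger0_norm; first by under [leRHS]eq_bigr do rewrite mxE.
  by apply: prodr_ge0 => i _; rewrite mxE exprn_ge0// ltW.
exists (ball a (rho / 2)); split.
- by apply: ball_open; rewrite divr_gt0.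
- by apply: ballxx; rewrite divr_gt0.
apply: Ck_eq (Ck_power_series a rho0 cS k [ffun=> 0%N]).
  by apply: ball_open; rewrite divr_gt0.
move=> x Vx; apply: cvg_lim => //.
have rd : rho / 2 <= d by rewrite /rho; lra.
have [_ wx] := dP x (le_ball rd Vx).
rewrite (_ : (fun N => _) = fun N => \sum_(be : {ffun 'I_n -> 'I_N})
  c [ffun i => be i : nat] * monomial (fun i => be i) (x - a))//.
apply/funext => N; rewrite /psum big_map; apply: eq_bigr => be _; congr (_ * _).
apply: eq_bigr => i _; rewrite /fmono !ffunE ffactn0 mul1r subn0.
by rewrite !mxE.
Qed.

Theorem mainTheorem7 (R : realType) (n : nat) (Omega : set 'rV[R]_n)
    (w u : 'rV[R]_n -> R) :
  open Omega ->
  real_analytic Omega w ->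
  (forall x, Omega x -> 0 < w x) ->
  strongly_harmonic Omega w u ->
  forall l : nat,
    (forall x, Omega x -> 0 < iter l laplacian w x) ->
    strongly_harmonic Omega (iter l laplacian w) u.
Proof.
move=> oO aw w0 sh l wl0.
by apply: strongly_harmonic_laplacian => // k; exact: real_analytic_Ck.
Qed.
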